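(* Let $v>1$ be an integer such that every component $q$ of $v$ satisfies $q>9$ and $q\equiv1\pmod 8$. Then there exists an S$(2,\{2,4\},2v)$ which is harmonious under $\mathbb Z_2\times\mathbb F_v$.
   Context: The components of an integer $v$ are the maximal prime power divisors of $v$; $\mathbb F_v$ denotes the ring which is the direct product of the finite fields whose orders are the components of $v$ (its additive group is used). A linear space S$(2,K,v)$: $v$ points, blocks with sizes in $K$ (every element of $K$ occurring), every pair of points in exactly one block; a resolution partitions the blocks into parallel classes each partitioning the points. A linear space is harmonious under an additive group $\Gamma$ if it has point set $\Gamma$ and a resolution such that the group of translations of $\Gamma$ is an automorphism group of the resolved linear space acting sharply transitively on points and transitively on parallel classes. *)

(* Defs.v *)
From HB Require Import structures.
From mathcomp Require Import all_boot all_algebra all_fingroup all_field.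

Set Implicit Arguments.
Unset Strict Implicit.
Unset Printing Implicit Defensive.

Import GRing.Theory.

Definition components (v : nat) : seq nat := [seq v`_p | p : nat <- primes v]%N.

Section FieldProduct.

Variables (I : finType) (F : I -> finFieldType).
Local Open Scope ring_scope.

Definition field_prod : Type := {dffun forall i, F i}.

HB.instance Definition _ := Finite.on field_prod.

Implicit Types x y z : field_prod.

Definition fprod_zero : field_prod := [ffun i : I => 0 : F i].
Definition fprod_one : field_prod := [ffun i : I => 1 : F i].
Definition fprod_opp x : field_prod := [ffun i : I => - x i : F i].
Definition fprod_add x y : field_prod := [ffun i : I => x i + y i : F i].
Definition fprod_mul x y : field_prod := [ffun i : I => x i * y i : F i].

Fact fprod_addA : associative fprod_add.
Proof. by move=> x y z; apply/ffunP=> i; rewrite !ffunE addrA. Qed.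

Fact fprod_addC : commutative fprod_add.
Proof. by move=> x y; apply/ffunP=> i; rewrite !ffunE addrC. Qed.

Fact fprod_add0 : left_id fprod_zero fprod_add.
Proof. by move=> x; apply/ffunP=> i; rewrite !ffunE add0r. Qed.

Fact fprod_addN : left_inverse fprod_zero fprod_opp fprod_add.
Proof. by move=> x; apply/ffunP=> i; rewrite !ffunE addNr. Qed.

HB.instance Definition _ := GRing.isZmodule.Build field_prod
  fprod_addA fprod_addC fprod_add0 fprod_addN.

Fact fprod_mulA : associative fprod_mul.
Proof. by move=> x y z; apply/ffunP=> i; rewrite !ffunE mulrA. Qed.

Fact fprod_mulC : commutative fprod_mul.
Proof. by move=> x y; apply/ffunP=> i; rewrite !ffunE mulrC. Qed.

Fact fprod_mul1 : left_id fprod_one fprod_mul.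
Proof. by move=> x; apply/ffunP=> i; rewrite !ffunE mul1r. Qed.

Fact fprod_mulDl : left_distributive fprod_mul fprod_add.
Proof. by move=> x y z; apply/ffunP=> i; rewrite !ffunE mulrDl. Qed.

HB.instance Definition _ := GRing.Zmodule_isComPzRing.Build field_prod
  fprod_mulA fprod_mulC fprod_mul1 fprod_mulDl.

End FieldProduct.

Section ComponentFields.

Variables (v : nat) (i : seq_sub (primes v)).

Fact seq_sub_primeP : prime (ssval i) /\ (0 < logn (ssval i) v)%N.
Proof.
have Pi : ssval i \in primes v by apply: ssvalP.
by split; [move: Pi; rewrite mem_primes => /andP[] | rewrite logn_gt0].
Qed.

(* The finite field of order v`_p, where p = ssval i. *)
Definition comp_field : finFieldType :=
  s2val (pPrimePowerField (proj1 seq_sub_primeP) (proj2 seq_sub_primeP)).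

Fact card_comp_field : #|comp_field| = (v`_(ssval i))%N.
Proof. by rewrite (s2valP' (pPrimePowerField _ _)) p_part. Qed.

End ComponentFields.

(* The components are indexed by the prime divisors of v. *)
Definition Fring (v : nat) : Type := field_prod (@comp_field v).

HB.instance Definition _ (v : nat) := Finite.on (Fring v).
HB.instance Definition _ (v : nat) := GRing.ComPzRing.on (Fring v).

HB.instance Definition _ (U V : finZmodType) := GRing.Zmodule.on (U * V)%type.

Section LinearSpaces.

Variable T : finType.
Implicit Types (B C : {set {set T}}) (R : {set {set {set T}}}).

Definition linear_space (K : seq nat) (v : nat) B : Prop :=
  [/\ #|T| = v,
      forall b, b \in B -> #|b| \in K,
      forall k, k \in K -> exists2 b, b \in B & #|b| = k
    & forall x y : T, x != y ->
        exists! b : {set T}, b \in B /\ [/\ x \in b & y \in b]].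

Definition parallel_class C : bool := partition C [set: T].

Definition resolution B R : Prop :=
  partition R B /\ forall C, C \in R -> parallel_class C.

(* Permutations of the points preserving the blocks and the parallel classes;
   'P, 'P^* and 'P^*^* are the actions of a permutation on points, on sets of
   points and on sets of sets of points. *)
Definition resolved_aut B R : {set {perm T}} :=
  'N(B | 'P^*)%g :&: 'N(R | 'P^*^*)%g.

Definition sharply_transitive (G : {set {perm T}}) : Prop :=
  forall x y : T, exists! s : {perm T}, s \in G /\ s x = y.

End LinearSpaces.

Section Harmonious.

Variable Gamma : finZmodType.
Local Open Scope ring_scope.

Definition translation (g : Gamma) : {perm Gamma} := perm (addIr g).

Definition translations : {set {perm Gamma}} :=
  [set translation g | g : Gamma].

Fact translations_group_set : group_set translations.
Proof.
apply/group_setP; split=> [|_ _ /imsetP[g _ ->] /imsetP[h _ ->]].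
  by apply/imsetP; exists 0 => //; apply/permP=> x; rewrite perm1 permE addr0.
apply/imsetP; exists (g + h) => //.
by apply/permP=> x; rewrite permM !permE addrA.
Qed.
Canonical translations_group := Group translations_group_set.

Definition harmonious (B : {set {set Gamma}}) : Prop :=
  exists R : {set {set {set Gamma}}},
    [/\ resolution B R,
        translations \subset resolved_aut B R,
        sharply_transitive translations
      & [transitive translations, on R | 'P^*^*]%g].

End Harmonious.

(* Main.v *)
Require Import Defs.
From Stdlib Require Import PArith NArith.
From HB Require Import structures.
From mathcomp Require Import all_boot all_order all_algebra all_fingroup.
From mathcomp Require Import all_solvable all_field.
From mathcomp Require Import ring zify.

Set Implicit Arguments.
Unset Strict Implicit.
Unset Printing Implicit Defensive.

Import Order.TTheory GRing.Theory Num.Theory.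
Local Open Scope ring_scope.

(** The linear space is developed from one parallel class that is invariant
    under Z_2: it consists of the line {0, 1} x {0} and of the Z_2-translates of
    blocks of sizes 4 and 2 whose projections partition the nonzero elements of
    the additive group G and whose differences cover each (t, y) with y != 0
    exactly once.  Such "designs" on G compose along direct sums, so it is enough
    to find one on every field of order q = 4n + 1 with n even and q > 9.

    On such a field one quadruple (a, b, c, d) suffices when each of the lists
    [a, b, c, d], [a-b, b-c, c-a, c-d], [a-d, b-d, c-d, a-b] meets all four
    cosets of the fourth powers; the remaining pairs are {-c, -d} and {-a, -b},
    and the quadruple is multiplied by representatives of the fourth powers
    modulo -1.  For n >= 10500 a quadruple is found with a = 1 by a second moment
    argument resting on the count of the z with (z - y)/(z - y') a fourth power.
    Smaller fields are settled by explicit quadruples, except q = 17, where no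
    such quadruple exists and a design is given directly. *)

(** * Developing a parallel class *)

(** The residue 1 modulo 8 enters twice. A system of base blocks has eight positions and, for either
    Z_2-difference, four pairs of points with two orientations each; so (q - 1) / 8 systems match
    the q - 1 nonzero elements in all three counts. Moreover -1 is then a fourth power, so the coset
    of a difference does not depend on its orientation, and the field becomes a complete graph whose
    edges are coloured by the four cosets of the fourth powers.

    In this graph a good quadruple is four vertices with prescribed patterns of cosets and colours.
    For large q an elementary count takes the place of bounds on character sums: two vertices y, y'
    are joined to z in the same colour for at most n - 1 of the z, so a set Y is split almost evenly
    among the four colours from most z. Few z deviate, and one can choose z, c, d outside the
    deviating sets. The threshold for n is where sets of 2 w candidates, with w about n / 34, first
    satisfy 9 q < (2 w)^2. *)

Section BaseClass.

Variable Gamma : finZmodType.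
Implicit Types (b : {set Gamma}) (P : {set {set Gamma}}) (g x y d : Gamma).

Definition shift b g : {set Gamma} := [set x + g | x in b].

Definition shifts P g : {set {set Gamma}} := [set shift b g | b in P].

Lemma mem_shift b g x : (x \in shift b g) = (x - g \in b).
Proof.
apply/imsetP/idP => [[y yb ->]|xb]; first by rewrite addrK.
by exists (x - g); rewrite ?subrK.
Qed.

Lemma shift_shift b g h : shift (shift b g) h = shift b (g + h).
Proof. by apply/setP=> x; rewrite !mem_shift opprD addrA addrAC. Qed.

Lemma shift0 b : shift b 0 = b.
Proof. by apply/setP=> x; rewrite mem_shift subr0. Qed.

Lemma shift_inj g : injective (shift^~ g).
Proof.
move=> b c /(congr1 (shift^~ (- g))).
by rewrite !shift_shift subrr !shift0.
Qed.

Lemma mem_shifts P g b : (b \in shifts P g) = (shift b (- g) \in P).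
Proof.
apply/imsetP/idP => [[c cP ->]|bP]; first by rewrite shift_shift subrr shift0.
by exists (shift b (- g)); rewrite // shift_shift addNr shift0.
Qed.

Lemma shifts_shifts P g h : shifts (shifts P g) h = shifts P (g + h).
Proof.
by apply/setP=> b; rewrite !mem_shifts shift_shift opprD addrC.
Qed.

Lemma shifts0 P : shifts P 0 = P.
Proof. by apply/setP=> b; rewrite mem_shifts oppr0 shift0. Qed.

Lemma card_shift b g : #|shift b g| = #|b|.
Proof. by rewrite card_imset //; apply: addIr. Qed.

Lemma act_shift b g : 'P^*%act b (translation g) = shift b g.
Proof. by apply: eq_imset => x; rewrite /= /aperm permE. Qed.

Lemma act_shifts P g : 'P^*^*%act P (translation g) = shifts P g.
Proof. by apply: eq_imset => b; rewrite act_shift. Qed.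

Lemma partition_shifts P g :
  partition P [set: Gamma] -> partition (shifts P g) [set: Gamma].
Proof.
case/and3P=> /eqP covP /trivIsetP trivP P0; apply/and3P; split.
- rewrite -subTset; apply/subsetP=> x _.
  have: x - g \in cover P by rewrite covP inE.
  case/bigcupP=> b bP xb; apply/bigcupP; exists (shift b g).
    by rewrite mem_shifts shift_shift subrr shift0.
  by rewrite mem_shift.
- apply/trivIsetP=> b c; rewrite !mem_shifts => bP cP ne.
  have := trivP _ _ bP cP; rewrite (inj_eq (@shift_inj _)) => /(_ ne).
  rewrite !disjoints_subset => /subsetP sub; apply/subsetP=> x xb.
  by have := sub (x - g); rewrite !inE !mem_shift opprK subrK; apply.
- rewrite mem_shifts; apply: contra P0.
  suff -> : shift set0 (- g) = set0 by [].
  by apply/setP=> x; rewrite mem_shift !inE.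
Qed.

Lemma sharply_transitive_translations :
  sharply_transitive (translations Gamma).
Proof.
move=> x y; exists (translation (y - x)); split.
  by split; [apply: imset_f | rewrite permE addrC subrK].
by move=> _ [/imsetP[g _ ->]]; rewrite permE => <-; rewrite addrAC subrr add0r.
Qed.

(** [E] holds translations that stabilise [P]. A class with a nontrivial stabiliser repeats its
    differences, so their uniqueness can be required only up to a shift by [E]. *)
Variables (P : {set {set Gamma}}) (E : {set Gamma}).
Hypothesis partP : partition P [set: Gamma].
Hypothesis stabP : forall e b, e \in E -> b \in P -> shift b e \in P.
Hypothesis sizeP : forall b, b \in P -> (1 < #|b|)%N.
Hypothesis diffP : forall d, d != 0 ->
  exists2 b, b \in P & exists x y, [/\ x \in b, y \in b & x - y = d].
Hypothesis diff_uniqP : forall b b' x y x' y', b \in P -> b' \in P ->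
  x \in b -> y \in b -> x' \in b' -> y' \in b' -> x != y ->
  x - y = x' - y' -> exists2 e, e \in E & b' = shift b e /\ x' = x + e.

Definition developed : {set {set Gamma}} := [set shift b g | b in P, g in setT].
Definition developed_classes : {set {set {set Gamma}}} :=
  [set shifts P g | g in setT].

Lemma developedP c :
  reflect (exists2 b, b \in P & exists g, c = shift b g) (c \in developed).
Proof.
apply: (iffP imset2P) => [[b g bP _ ->]|[b bP [g ->]]]; first by exists b; eauto.
by exists b g; rewrite ?inE.
Qed.

Lemma stab_shifts e : e \in E -> shifts P e = P.
Proof.
move=> eE; apply/eqP; rewrite eqEcard; apply/andP; split.
  by apply/subsetP=> _ /imsetP[b bP ->]; apply: stabP.
by rewrite card_imset //; apply: shift_inj.
Qed.

(** Both blocks realise the difference x - y, hence b' is b shifted by some e in [E], and following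
    the point x gives g = e + g'. The equality of blocks yields the linear space, that of classes
    the resolution. *)
Lemma developed_same b b' g g' x y : b \in P -> b' \in P -> x != y ->
    x \in shift b g -> y \in shift b g -> x \in shift b' g' ->
    y \in shift b' g' ->
  shift b g = shift b' g' /\ shifts P g = shifts P g'.
Proof.
move=> bP bP' nxy; rewrite !mem_shift => xb yb xb' yb'.
have [||e eE [-> /eqP]] := diff_uniqP bP bP' xb yb xb' yb'.
- by rewrite (inj_eq (addIr _)).
- by rewrite !opprB !addrA !subrK.
rewrite -addrA (inj_eq (addrI _)) => /eqP eg.
have -> : g = e + g' by rewrite -[g']opprK eg opprD opprK addrCA subrr addr0.
by rewrite shift_shift -shifts_shifts stab_shifts.
Qed.

Lemma developed_linear x y : x != y ->
  exists! b : {set Gamma}, b \in developed /\ [/\ x \in b & y \in b].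
Proof.
move=> nxy; have [|b bP [x' [y' [xb yb dxy]]]] := @diffP (x - y).
  by rewrite subr_eq0.
have ey : y' + (x - x') = y.
  by rewrite addrCA -opprB dxy opprB addrC subrK.
have ex : x' + (x - x') = x by rewrite addrC subrK.
have [xs ys] : x \in shift b (x - x') /\ y \in shift b (x - x').
  by rewrite -{1}ex -{1}ey; split; apply: imset_f.
exists (shift b (x - x')); split.
  by split; first by apply/developedP; exists b; eauto.
move=> _ [/developedP[b' bP' [g ->]] [xb' yb']].
by case: (developed_same bP bP' nxy xs ys xb' yb').
Qed.

Lemma developed_harmonious : harmonious developed.
Proof.
(* Two distinct points of a block determine the class that contains it; a singleton would not. *)
have T : forall b, b \in P -> exists2 x, x \in b & exists2 y, y \in b & x != y.
  move=> b bP; case/card_gt1P: (sizeP bP) => x [y [xb yb ne]].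
  by exists x => //; exists y.
exists developed_classes; split.
- split; last first.
    by move=> _ /imsetP[g _ ->]; apply: partition_shifts.
  apply/and3P; split.
  + apply/eqP/setP=> c; apply/bigcupP/developedP.
      case=> _ /imsetP[g _ ->] /imsetP[b bP ->]; exists b => //.
      by exists g.
    case=> b bP [g ->]; exists (shifts P g); first exact: imset_f.
    exact: imset_f.
  + apply/trivIsetP=> _ _ /imsetP[g _ ->] /imsetP[h _ ->].
    apply: contraR => /pred0Pn[_ /andP[/imsetP[b bP ->] /imsetP[c cP eq_bc]]].
    have [x xb [y yb ne]] := T _ bP.
    have [xs ys] : x + g \in shift b g /\ y + g \in shift b g.
      by split; apply: imset_f.
    have [xt yt] : x + g \in shift c h /\ y + g \in shift c h by rewrite -eq_bc.
    have ne' : x + g != y + g by rewrite (inj_eq (addIr _)).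
    by case: (developed_same bP cP ne' xs ys xt yt) => _ ->.
  + apply/imsetP=> -[g _ E0].
    have [b bP] : exists b, b \in P.
      case/and3P: partP => /eqP/setP/(_ 0); rewrite inE => /bigcupP[b bP _].
      by exists b.
    by have: shift b g \in shifts P g; [apply: imset_f | rewrite -E0 inE].
- apply/subsetP=> _ /imsetP[g _ ->]; apply/setIP; split.
    apply/astabsP=> c; rewrite act_shift; apply/developedP/developedP.
      case=> b bP [h /(congr1 (shift^~ (- g)))].
      rewrite !shift_shift subrr shift0 => ->; exists b => //; eexists.
      by [].
    case=> b bP [h ->]; exists b => //; exists (h + g).
    by rewrite shift_shift.
  apply/astabsP=> C; rewrite act_shifts; apply/imsetP/imsetP.
    case=> h _ /(congr1 (shifts^~ (- g))).
    by rewrite !shifts_shifts subrr shifts0 => ->; exists (h - g).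
  by case=> h _ ->; exists (h + g); rewrite ?shifts_shifts.
- exact: sharply_transitive_translations.
- apply/imsetP; exists P.
    by apply/imsetP; exists 0; rewrite ?shifts0.
  apply/setP=> C; apply/imsetP/orbitP.
    case=> g _ ->; exists (translation g); first exact: imset_f.
    by rewrite act_shifts.
  by case=> _ /imsetP[g _ ->] <-; exists g; rewrite ?act_shifts.
Qed.

End BaseClass.

(** * The parallel class of a design *)

(* The points of the base blocks {A, B, C, D}, {E, F} and {G, H}; D and H get
   the Z_2-coordinate 1, the others 0. *)
Inductive pos := pA | pB | pC | pD | pE | pF | pG | pH.

Lemma pos_comparable : comparable pos.
Proof. by case; case; by [left|right]. Defined.
HB.instance Definition _ := comparableMixin pos_comparable.

Inductive edge := e1 | e2 | e3 | e4.

(* For t = 0, 1 the edges from [esrc t e] to [etgt t e] are, up to orientation,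
   the four pairs of points of a common block with Z_2-difference t. *)
Definition esrc (t : bool) (e : edge) : pos :=
  if t then match e with e1 => pA | e2 => pB | e3 => pC | e4 => pG end
  else match e with e1 => pA | e2 => pB | e3 => pC | e4 => pE end.

Definition etgt (t : bool) (e : edge) : pos :=
  if t then match e with e1 => pD | e2 => pD | e3 => pD | e4 => pH end
  else match e with e1 => pB | e2 => pC | e3 => pA | e4 => pF end.

Definition label (p : pos) : 'Z_2 := match p with pD | pH => 1 | _ => 0 end.

Definition block_of (p : pos) : option bool :=
  match p with pE | pF => Some false | pG | pH => Some true | _ => None end.

Definition signed (V : zmodType) (s : bool) (y : V) := if s then - y else y.

Definition exact_on (V : zmodType) (H : pred V) (K : Type) (f : K -> V) :=
  injective f /\ forall y, (y != 0) && H y <-> exists k, f k = y.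

Definition edge_diff (V : zmodType) (I : Type) (x : I -> pos -> V) t
    (k : I * edge * bool) :=
  let: (i, e, s) := k in signed s (x i (esrc t e) - x i (etgt t e)).

(** The group is a predicate [H] on an ambient [V], so that designs on growing partial sums of a
    product all live in one type. *)
Definition design_on (V : zmodType) (H : pred V) (I : Type)
    (x : I -> pos -> V) :=
  exact_on H (fun k : I * pos => x k.1 k.2) /\
  forall t, exact_on H (edge_diff x t).

Lemma label_edge t e : label (esrc t e) - label (etgt t e) = t%:R.
Proof. by case: t; case: e; apply/eqP. Qed.

Lemma block_of_edge t e : block_of (esrc t e) = block_of (etgt t e).
Proof. by case: t; case: e. Qed.

Lemma edge_exists p p' : block_of p = block_of p' -> p != p' ->
  exists t e s, p = (if s then etgt t e else esrc t e) /\
                p' = (if s then esrc t e else etgt t e).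
Proof.
move=> + /eqP; case: p; case: p' => // _ _;
  do [by exists false, e1, false | by exists false, e1, true
    | by exists false, e2, false | by exists false, e2, true
    | by exists false, e3, false | by exists false, e3, true
    | by exists false, e4, false | by exists false, e4, true
    | by exists true, e1, false | by exists true, e1, true
    | by exists true, e2, false | by exists true, e2, true
    | by exists true, e3, false | by exists true, e3, true
    | by exists true, e4, false | by exists true, e4, true].
Qed.

Lemma Z2_bool (t : 'Z_2) : exists b : bool, t = b%:R.
Proof.
by case: t => [[|[|//]]] lt2; [exists false | exists true]; apply: val_inj.
Qed.

Lemma Z2_opp (t : 'Z_2) : - t = t.
Proof. by case: (Z2_bool t) => -[] ->; apply/eqP. Qed.

Section DesignClass.

Variables (G : finZmodType) (I : finType) (x : I -> pos -> G).
Hypothesis xP : design_on predT x.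
Local Notation Gamma := ('Z_2 * G)%type.
Implicit Types (i : I) (e : 'Z_2) (k : option bool) (z : Gamma).

Definition point i e p : Gamma := (label p + e, x i p).

Definition block_pos k : seq pos :=
  match k with None => [:: pA; pB; pC; pD]
  | Some false => [:: pE; pF] | Some true => [:: pG; pH] end.

Definition block i e k : {set Gamma} :=
  [set z | z \in [seq point i e p | p <- block_pos k]].

Definition vertical : {set Gamma} := [set z | z.2 == 0].

Definition base_class : {set {set Gamma}} :=
  vertical |: [set block u.1.1 u.1.2 u.2 | u : I * 'Z_2 * option bool].

Lemma base_classP b : b \in base_class ->
  b = vertical \/ exists i e k, b = block i e k.
Proof.
case/setU1P=> [->|/imsetP[[[i e] k] _ ->]]; first by left.
by right; exists i, e, k.
Qed.

Lemma block_base i e k : block i e k \in base_class.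
Proof. by apply/setU1P; right; apply/imsetP; exists (i, e, k). Qed.

Lemma vertical_base : vertical \in base_class.
Proof. exact: setU11. Qed.

Lemma mem_block_pos p k : (p \in block_pos k) = (block_of p == k).
Proof. by case: k => [[]|]; case: p. Qed.

Lemma blockP i e k z :
  reflect (exists2 p, block_of p = k & z = point i e p) (z \in block i e k).
Proof.
rewrite inE; apply: (iffP mapP) => -[p pk ->]; exists p => //.
  by apply/eqP; rewrite -mem_block_pos.
by rewrite mem_block_pos pk.
Qed.

Lemma x_inj i i' p p' : x i p = x i' p' -> i = i' /\ p = p'.
Proof. by case: xP => -[inj _] _ /(inj (i, p) (i', p')) []. Qed.

Lemma x_neq0 i p : x i p != 0.
Proof.
case: xP => -[_ /(_ (x i p))[_]]; rewrite andbT => H _.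
by apply: H; exists (i, p).
Qed.

Lemma point_inj i e i' e' p p' :
  point i e p = point i' e' p' -> [/\ i = i', e = e' & p = p'].
Proof.
move=> eq_pt; have [-> ep] := x_inj (congr1 snd eq_pt).
by have := congr1 fst eq_pt; rewrite /= ep => /addrI ->.
Qed.

Lemma card_block i e k : #|block i e k| = if k is None then 4%N else 2%N.
Proof.
rewrite cardsE (card_uniqP _) ?size_map; first by case: k => [[]|].
rewrite map_inj_uniq; first by case: k => [[]|].
by move=> p p' /point_inj[].
Qed.

Lemma card_vertical : #|vertical| = 2%N.
Proof.
have -> : vertical = [set ((t, 0) : Gamma) | t : 'Z_2].
  apply/setP=> -[t y]; rewrite inE /=; apply/eqP/imsetP => [->|[u _ [_ ->]]] //.
  by exists t.
by rewrite card_imset ?card_ord // => t u [].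
Qed.

Lemma block_mem i e k i' e' k' z :
  z \in block i e k -> z \in block i' e' k' -> block i e k = block i' e' k'.
Proof. by case/blockP=> p <- -> /blockP[p' <- /point_inj[-> -> ->]]. Qed.

Lemma mem_base_uniq b b' z : b \in base_class -> b' \in base_class ->
  z \in b -> z \in b' -> b = b'.
Proof.
have V i e k : z \in block i e k -> z \in vertical -> False.
  by case/blockP=> p _ ->; rewrite inE /= (negbTE (x_neq0 _ _)).
case/base_classP=> [->|[i [e [k ->]]]] /base_classP[->|[i' [e' [k' ->]]]] //.
- by move=> zV /V/(_ zV).
- by move=> /V h /h.
exact: block_mem.
Qed.

Lemma card_base b : b \in base_class -> #|b| \in [:: 2; 4]%N.
Proof.
case/base_classP=> [->|[i [e [k ->]]]]; first by rewrite card_vertical.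
by rewrite card_block; case: k.
Qed.

Lemma partition_base : partition base_class [set: Gamma].
Proof.
apply/and3P; split.
- rewrite -subTset; apply/subsetP=> -[t y] _; apply/bigcupP.
  have [->|y0] := eqVneq y 0; first by exists vertical; rewrite ?setU11 ?inE.
  have [_ /(_ y)] := proj1 xP; rewrite y0 => -[/(_ isT)[[i p] /= <-] _].
  exists (block i (t - label p) (block_of p)); first exact: block_base.
  by apply/blockP; exists p; rewrite // /point addrC subrK.
- apply/trivIsetP=> b b' bP bP'; apply: contraR => /pred0Pn[z /andP[zb zb']].
  by apply/eqP; apply: mem_base_uniq zb zb'.
- by apply/negP=> /card_base; rewrite cards0.
Qed.

Lemma point_shift i e p (t : 'Z_2) : point i (e + t) p = point i e p + (t, 0).
Proof. by rewrite -[RHS]/(label p + e + t, x i p + 0) addr0 -addrA. Qed.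

Lemma shift_block i e k (t : 'Z_2) :
  shift (block i e k) (t, 0) = block i (e + t) k.
Proof.
apply/setP=> z; rewrite mem_shift; apply/blockP/blockP => -[p pk].
  move=> /eqP; rewrite subr_eq => /eqP ->; exists p => //.
  by rewrite point_shift.
move=> ->; exists p => //; apply/eqP; rewrite subr_eq; apply/eqP.
by rewrite -point_shift.
Qed.

Lemma shift_vertical z : z \in vertical -> shift vertical z = vertical.
Proof.
rewrite inE => /eqP z0; apply/setP=> u.
by rewrite mem_shift !inE -[(u - z).2]/(u.2 - z.2) z0 subr0.
Qed.

Lemma base_stab z b :
  z \in vertical -> b \in base_class -> shift b z \in base_class.
Proof.
move=> zV /base_classP[->|[i [e [k ->]]]].
  by rewrite shift_vertical ?vertical_base.
move: zV; rewrite inE; case: z => t y /= /eqP->.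
by rewrite shift_block block_base.
Qed.

Lemma edge_diff_neq0 t (k : I * edge * bool) : edge_diff x t k != 0.
Proof.
case: xP => _ /(_ t)[_ /(_ (edge_diff x t k))[_ h]].
by move: (h (ex_intro _ k erefl)); rewrite andbT.
Qed.

(** Reversing an edge leaves its Z_2-difference unchanged, because t = - t there; the sign [s] acts
    on the other coordinate only. *)
Lemma point_diff i e t a s :
  point i e (if s then etgt t a else esrc t a) -
    point i e (if s then esrc t a else etgt t a) =
  (t%:R, edge_diff x t (i, a, s)).
Proof.
rewrite -[LHS]/(label _ + e - (label _ + e), x i _ - x i _).
rewrite opprD addrACA subrr addr0; congr pair.
  by case: s; rewrite -(label_edge t a) // -[LHS]Z2_opp opprB.
by case: s; rewrite //= opprB.
Qed.

Lemma base_diff (d : Gamma) : d != 0 -> exists2 b, b \in base_class &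
  exists u w, [/\ u \in b, w \in b & u - w = d].
Proof.
case: d => t y; have [->|y0] := eqVneq y 0.
  move=> _; exists vertical; rewrite ?vertical_base //; exists (t, 0), 0.
  by rewrite !inE subr0 /=.
have [b ->] := Z2_bool t => _.
have [_ /(_ y)] := proj2 xP b; rewrite y0 => -[/(_ isT)[[[i a] s] <-] _].
exists (block i 0 (block_of (esrc b a))); first exact: block_base.
eexists; eexists; split; last exact: (point_diff i 0 b a s).
  by apply/blockP; eexists; last reflexivity; case: s; rewrite ?block_of_edge.
by apply/blockP; eexists; last reflexivity; case: s; rewrite ?block_of_edge.
Qed.

Lemma block_diff i e k u w : u \in block i e k -> w \in block i e k -> u != w ->
  exists t a s, u = point i e (if s then etgt t a else esrc t a) /\
    u - w = (t%:R, edge_diff x t (i, a, s)).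
Proof.
case/blockP=> p <- -> /blockP[p' pp' ->] ne.
have {}ne : p != p' by apply: contra ne => /eqP->.
have [t [a [s [-> ->]]]] := edge_exists (esym pp') ne.
by exists t, a, s; rewrite point_diff.
Qed.

Lemma vertical_diff u w : u \in vertical -> w \in vertical -> (u - w).2 = 0.
Proof. by rewrite !inE => /eqP u0 /eqP w0; rewrite /= u0 w0 subr0. Qed.

(** The difference determines the system, the edge and its orientation, so only the Z_2-translate of
    the block remains free, and changing it is a vertical shift. Differences inside the vertical
    line have second coordinate 0, which no edge attains. *)
Lemma base_diff_uniq b b' (u w u' w' : Gamma) :
  b \in base_class -> b' \in base_class ->
  u \in b -> w \in b -> u' \in b' -> w' \in b' -> u != w ->
  u - w = u' - w' ->
  exists2 z, z \in vertical & b' = shift b z /\ u' = u + z.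
Proof.
move=> bP bP' ub wb ub' wb' ne eq_d.
have ne' : u' != w' by rewrite -subr_eq0 -eq_d subr_eq0.
case/base_classP: bP ub wb => [->|[i [e [k ->]]]] ub wb;
case/base_classP: bP' ub' wb' => [->|[i' [e' [k' ->]]]] ub' wb'.
- exists (u' - u); first by rewrite inE vertical_diff.
  by rewrite shift_vertical ?inE ?vertical_diff // addrC subrK.
- have [t [a [s [_ d']]]] := block_diff ub' wb' ne'.
  case/eqP: (edge_diff_neq0 t (i', a, s)).
  by have := vertical_diff ub wb; rewrite eq_d d'.
- have [t [a [s [_ d']]]] := block_diff ub wb ne.
  case/eqP: (edge_diff_neq0 t (i, a, s)).
  by have := vertical_diff ub' wb'; rewrite -eq_d d'.
have [t [a [s [eu du]]]] := block_diff ub wb ne.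
have [t' [a' [s' [eu' du']]]] := block_diff ub' wb' ne'.
move: eq_d; rewrite du du' => -[et ed].
have {}et : t = t' by case: t t' et {eu du eu' du' ed} => -[].
subst t'; have [inj _] := proj2 xP t.
have [? ? ?] := inj (i, a, s) (i', a', s') ed; subst i' a' s'.
have euu : u' = u + (e' - e, 0).
  by rewrite eu eu' -point_shift addrC subrK.
exists (e' - e, 0); first by rewrite inE.
split=> //; rewrite shift_block addrC subrK.
have: u' \in block i e' k.
  by rewrite -[e'](subrK e) addrC -shift_block mem_shift euu addrK.
exact: block_mem.
Qed.

Lemma design_harmonious : (1 < #|G|)%N ->
  exists B : {set {set Gamma}},
    linear_space [:: 2; 4]%N (2 * #|G|)%N B /\ harmonious B.
Proof.
move=> G1; exists (developed base_class).
have sizeP b : b \in base_class -> (1 < #|b|)%N.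
  by move/card_base; rewrite !inE => /orP[]/eqP->.
have dev b : b \in base_class -> b \in developed base_class.
  by move=> bP; apply/developedP; exists b => //; exists 0; rewrite shift0.
split; last first.
  exact: (developed_harmonious partition_base base_stab sizeP base_diff_uniq).
split.
- by rewrite card_prod card_ord.
- by move=> _ /developedP[b bP [g ->]]; rewrite card_shift card_base.
- move=> k; rewrite !inE => /orP[]/eqP->.
    by exists vertical; rewrite ?card_vertical // dev // vertical_base.
  (* Every listed size must occur: a nonzero element has to be covered, so [I] is inhabited and a
     block of size 4 exists. *)
  have [y y0] : exists y : G, y != 0.
    by case/card_gt1P: G1 => y [z [_ _ ne]]; exists (y - z); rewrite subr_eq0.
  have [_ /(_ y)] := proj1 xP; rewrite y0 => -[/(_ isT)[[i p] _] _].
  by exists (block i 0 None); rewrite ?card_block // dev // block_base.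
- exact: (developed_linear base_stab base_diff base_diff_uniq).
Qed.

End DesignClass.

(** * Direct sums *)

Lemma signedD (V : zmodType) s (y z : V) :
  signed s (y + z) = signed s y + signed s z.
Proof. by case: s; rewrite //= opprD. Qed.

Lemma exact_on_reindex (V : zmodType) (H : pred V) K L (f : K -> V) (g : L -> V)
    (h : L -> K) (h' : K -> L) : cancel h h' -> cancel h' h -> g =1 f \o h ->
  exact_on H f -> exact_on H g.
Proof.
move=> hK h'K eq_g [inj cov]; split=> [k l|y].
  by rewrite !eq_g => /inj/(can_inj hK).
split=> [/cov[k <-]|[k <-]]; first by exists (h' k); rewrite eq_g /= h'K.
by apply/cov; exists (h k); rewrite eq_g.
Qed.

Lemma exact_on_val (V : zmodType) K (f : K -> V) (P : pred V) k :
  exact_on P f -> f k != 0 /\ P (f k).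
Proof. by case=> _ /(_ (f k))[_ h]; apply/andP/h; exists k. Qed.

Section Compose.

Variables (V : zmodType) (F : fieldType) (H1 H : pred V) (psi : F -> V).
Hypothesis psiB : {morph psi : a b / a - b}.
Hypothesis H10 : H1 0.
Hypothesis sum_inj : forall h h' w w', H1 h -> H1 h' ->
  h + psi w = h' + psi w' -> h = h' /\ w = w'.
Hypothesis sumP : forall y, H y <-> exists h w, H1 h /\ y = h + psi w.

Lemma psi0 : psi 0 = 0.
Proof. by have := psiB 0 0; rewrite !subrr. Qed.

Lemma psiN : {morph psi : a / - a}.
Proof. by move=> a; rewrite -[- a]sub0r psiB psi0 sub0r. Qed.

Lemma psi_eq0 w : psi w = 0 -> w = 0.
Proof.
move=> w0; have [] // : 0 = 0 :> V /\ w = 0.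
by apply: sum_inj; rewrite // w0 psi0.
Qed.

(** Elements with nonzero component h in [H1] come from the unique k with f1 k = h, and
    multiplication by the nonzero c k then reaches every w once. Those with h = 0 are left to
    [f2]. *)
Lemma exact_on_sum K1 K2 (f1 : K1 -> V) (f2 : K2 -> F) (c : K1 -> F) :
  exact_on H1 f1 -> exact_on predT f2 -> (forall k, c k != 0) ->
  exact_on H (fun k : K1 * F + K2 => match k with
    | inl u => f1 u.1 + psi (c u.1 * u.2) | inr k2 => psi (f2 k2) end).
Proof.
move=> ex1 ex2 c0; split.
  move=> [[k w]|k] [[k' w']|k'] /=.
  - case/sum_inj; rewrite ?(exact_on_val _ ex1).2 // => /(proj1 ex1) <-.
    by move/(mulfI (c0 k)) => ->.
  - rewrite -[RHS]add0r => /sum_inj[]; rewrite ?(exact_on_val _ ex1).2 // => k0.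
    by case/eqP: (exact_on_val k ex1).1.
  - rewrite -[LHS]add0r => /sum_inj[]; rewrite ?(exact_on_val _ ex1).2 // => k0.
    by case/eqP: (exact_on_val k' ex1).1.
  - move=> e; congr inr; apply: (proj1 ex2).
    by have [|_ ->] := @sum_inj 0 0 (f2 k) (f2 k') H10 H10; rewrite ?add0r.
move=> y; split.
  case/andP=> y0 /sumP[h [w [H1h eqy]]]; have [h0|h0] := eqVneq h 0.
    have w0 : w != 0.
      by apply: contraNneq y0 => w0; rewrite eqy h0 w0 psi0 addr0.
    have [_ /(_ w)] := ex2; rewrite w0 => -[/(_ isT)[k2 fk] _].
    by exists (inr k2); rewrite fk eqy h0 add0r.
  have [_ /(_ h)] := ex1; rewrite h0 H1h => -[/(_ isT)[k fk] _].
  by exists (inl (k, (c k)^-1 * w)); rewrite /= mulVKf // fk.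
case=> [[[k w]|k] /= <-].
  have [k0 Hk] := exact_on_val k ex1; apply/andP; split; last first.
    by apply/sumP; exists (f1 k), (c k * w).
  apply: contraNneq k0 => e0; apply/eqP.
  by have [|-> _] := @sum_inj (f1 k) 0 (c k * w) 0 Hk H10; rewrite ?psi0 ?addr0.
have [k0 _] := exact_on_val k ex2; apply/andP; split.
  by apply: contraNneq k0 => /psi_eq0 ->.
by apply/sumP; exists 0, (f2 k); rewrite add0r.
Qed.

Variables (I1 I2 : Type) (x1 : I1 -> pos -> V) (x2 : I2 -> pos -> F).
Variable m : pos -> F.
Hypothesis m0 : forall p, m p != 0.
Hypothesis mB : forall t e, m (esrc t e) - m (etgt t e) != 0.

(** The products m p * w form a difference matrix: along an edge the rows differ by a nonzero
    multiple of w, so w runs through [F] in the differences as it does in the points. *)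
Definition sum_design (i : I1 * F + I2) p := match i with
  | inl u => x1 u.1 p + psi (m p * u.2) | inr i => psi (x2 i p) end.

Lemma sum_designP :
  design_on H1 x1 -> design_on predT x2 -> design_on H sum_design.
Proof.
move=> [P1 D1] [P2 D2]; split=> [|t].
  pose h (k : (I1 * F + I2) * pos) : (I1 * pos) * F + I2 * pos :=
    match k with
    | (inl (i, w), p) => inl ((i, p), w) | (inr i, p) => inr (i, p)
    end.
  pose h' (k : (I1 * pos) * F + I2 * pos) : (I1 * F + I2) * pos :=
    match k with
    | inl ((i, p), w) => (inl (i, w), p) | inr (i, p) => (inr i, p)
    end.
  have c0 (k : I1 * pos) : m k.2 != 0 by [].
  apply: (exact_on_reindex (h := h) (h' := h')) (exact_on_sum P1 P2 c0).
  - by case=> [[[i w]|i] p].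
  - by case=> [[[i p] w]|[i p]].
  - by case=> [[[i w]|i] p].
pose h (k : (I1 * F + I2) * edge * bool) :
    (I1 * edge * bool) * F + I2 * edge * bool :=
  match k with
  | (inl (i, w), e, s) => inl ((i, e, s), w) | (inr i, e, s) => inr (i, e, s)
  end.
pose h' (k : (I1 * edge * bool) * F + I2 * edge * bool) :
    (I1 * F + I2) * edge * bool :=
  match k with
  | inl ((i, e, s), w) => (inl (i, w), e, s) | inr (i, e, s) => (inr i, e, s)
  end.
pose c (k : I1 * edge * bool) :=
  signed k.2 (m (esrc t k.1.2) - m (etgt t k.1.2)).
have c0 k : c k != 0 by rewrite /c; case: k.2; rewrite /= ?oppr_eq0 mB.
have psi_signed s a : psi (signed s a) = signed s (psi a).
  by case: s; rewrite //= psiN.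
apply: (exact_on_reindex (h := h) (h' := h')) (exact_on_sum (D1 t) (D2 t) c0).
- by case=> [[[[i w]|i] e] s].
- by case=> [[[[i e] s] w]|[[i e] s]].
case=> [[[[i w]|i] e] s] /=; last by rewrite psi_signed psiB.
rewrite opprD addrACA -psiB -mulrBl [LHS]signedD; congr (_ + _).
by rewrite -psi_signed; congr psi; case: s; rewrite //= mulNr.
Qed.

End Compose.

Definition has_design (V : zmodType) (H : pred V) :=
  exists (I : finType) (x : I -> pos -> V), design_on H x.

(** The edges form a complete graph on A, B, C, D and two separate edges EF and GH, so four distinct
    nonzero values suffice. *)
Lemma multipliers (F : finFieldType) : (4 < #|F|)%N ->
  exists m : pos -> F, (forall p, m p != 0) /\
    forall t e, m (esrc t e) - m (etgt t e) != 0.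
Proof.
move=> F4; have : (3 < #|predC1 (0%R : F)|)%N.
  by rewrite cardC1 -ltnS prednK // (ltn_trans _ F4).
case/card_geqP=> -[|a [|b [|c [|d [|? ?]]]]] [] //=.
rewrite !inE !negb_or -!andbA => /and5P[ab ac ad bc /and3P[bd cd _]] _ sub.
have [a0 b0 c0 d0] : [/\ a != 0, b != 0, c != 0 & d != 0].
  by split; apply: sub; rewrite !inE eqxx ?orbT.
exists (fun p => match p with pA | pE | pG => a | pB | pF | pH => b
                 | pC => c | pD => d end); split; first by case.
by case; case; rewrite subr_eq0 //= eq_sym.
Qed.

(** * Designs on products of fields *)

Section FieldProd.

Variables (I : finType) (F : I -> finFieldType).
Hypothesis F4 : forall i, (4 < #|F i|)%N.
Hypothesis F_design : forall i, @has_design (F i) predT.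
Implicit Types (y : field_prod F) (s : seq I).

Definition supported s : pred (field_prod F) :=
  fun y => [forall i, (y i != 0) ==> (i \in s)].

Definition single i (w : F i) : field_prod F :=
  [ffun j => dfwith (fun j => 0 : F j) w j].

Lemma single_in i (w : F i) : single w i = w.
Proof. by rewrite ffunE dfwith_in. Qed.

Lemma single_out i (w : F i) j : i != j -> single w j = 0.
Proof. by move=> ij; rewrite ffunE dfwith_out. Qed.

Lemma fprodD y z i : (y + z) i = y i + z i.
Proof. by rewrite ffunE. Qed.

Lemma fprodN y i : (- y) i = - y i.
Proof. by rewrite ffunE. Qed.

Lemma fprod0 i : (0 : field_prod F) i = 0.
Proof. by rewrite ffunE. Qed.

Lemma supportedP s y : reflect (forall i, i \notin s -> y i = 0) (supported s y).
Proof.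
apply: (iffP forallP) => h i.
  by move=> si; apply/eqP; apply: contraNT si => /(implyP (h i)).
by apply/implyP; apply: contraR => /h ->.
Qed.

Lemma has_design_supported s : uniq s -> has_design (supported s).
Proof.
elim: s => [_|i s IHs /= /andP[si /IHs[I1 [x1 D1]]]].
  (* The zero group has no nonzero element to cover, so the empty design starts the induction. *)
  exists void, (fun v : void => match v with end).
  have triv K (f : K -> field_prod F) :
      (K -> False) -> exact_on (supported [::]) f.
    move=> K0; split=> [k|y]; first by case: (K0 k).
    split=> [|[k]]; last by case: (K0 k).
    case/andP=> y0 /supportedP yN; case/eqP: y0; apply/ffunP=> i.
    by rewrite fprod0 yN.
  by split=> [|t]; apply: triv; [case=> -[] | case=> [[[]]]].
have [I2 [x2 D2]] := F_design i; have [m [m0 mB]] := multipliers (F4 i).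
exists (I1 * F i + I2)%type, (sum_design (@single i) x1 x2 m).
apply: (@sum_designP _ _ (supported s)) => //.
- move=> a b; apply/ffunP=> j; rewrite fprodD fprodN; have [<-|ij] := eqVneq i j.
    by rewrite !single_in.
  by rewrite !single_out // subr0.
- by apply/supportedP=> j _; rewrite fprod0.
- move=> h h' w w' /supportedP hs /supportedP hs' eqh.
  have ew : w = w'.
    have := congr1 (fun y : field_prod F => y i) eqh.
    by rewrite !fprodD !single_in hs // hs' // !add0r.
  by split=> //; move: eqh; rewrite ew => /addIr.
move=> y; split.
  move/supportedP=> yP; exists (y - single (y i)), (y i).
  rewrite subrK; split=> //.
  apply/supportedP=> j js; rewrite fprodD fprodN; have [<-|ij] := eqVneq i j.
    by rewrite single_in subrr.
  by rewrite single_out // subr0 yP // inE negb_or eq_sym ij.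
case=> h [w [/supportedP hP ->]]; apply/supportedP=> j; rewrite inE negb_or.
by case/andP=> ji js; rewrite fprodD hP // single_out ?addr0 // eq_sym.
Qed.

Lemma has_design_prod : @has_design (field_prod F) predT.
Proof.
have [I1 [x [P D]]] := has_design_supported (enum_uniq I).
have eqH : forall y, supported (enum I) y = predT y.
  by move=> y; apply/supportedP=> i; rewrite mem_enum.
exists I1, x; split=> [|t].
  by split=> [|y]; [case: P | rewrite -eqH; case: P].
by split=> [|y]; [case: (D t) | rewrite -eqH; case: (D t)].
Qed.

End FieldProd.

Lemma card_Fring (v : nat) : (0 < v)%N -> #|{: Fring v}| = v.
Proof.
move=> v0.
have -> : #|{: Fring v}| = (\prod_(i : seq_sub (primes v)) v`_(ssval i))%N.
  rewrite [LHS]card_dep_ffun foldrE big_image.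
  by apply: eq_bigr => i _; rewrite card_comp_field.
rewrite [RHS]prod_prime_decomp // prime_decompE big_map.
rewrite -[primes v in RHS](val_seq_sub_enum (primes_uniq v)) big_map.
have -> : index_enum (seq_sub (primes v)) = seq_sub_enum (primes v).
  by rewrite [index_enum _]unlock; rewrite unlock.
by apply: eq_bigr => i _; rewrite p_part.
Qed.

(** * Good quadruples *)

Lemma natr_card0 (F : finFieldType) : #|F|%:R = 0 :> F.
Proof. by rewrite -cardsT -FinRing.zmodXgE expg_cardG ?inE. Qed.

Section Quartic.

Variables (F : finFieldType) (n : nat).
Hypothesis cardF : #|F| = (4 * n).+1.
Hypothesis n_even : ~~ odd n.
Implicit Types (x y z : F) (s : seq F).

(** The multiplicative group is cyclic of order 4 n, so x ^+ n is a fourth root of unity that labels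
    the coset of x modulo the fourth powers. *)
Definition rainbow s := (0 \notin s) && uniq [seq x ^+ n | x <- s].

Definition good_quadruple a b c d := [&& rainbow [:: a; b; c; d],
  rainbow [:: a - b; b - c; c - a; c - d] &
  rainbow [:: a - d; b - d; c - d; a - b]].

Lemma quartic_pow x : x != 0 -> (x ^+ n) ^+ 4 = 1.
Proof.
move=> x0; apply: (mulfI x0); rewrite mulr1 -exprM mulnC -exprS -cardF.
exact: expf_card.
Qed.

(** This says that -1 is a fourth power, so that the order in a difference is immaterial for its
    coset. *)
Lemma quarticN x : (- x) ^+ n = x ^+ n.
Proof. by rewrite exprNn -signr_odd (negbTE n_even) mul1r. Qed.

Lemma n_gt0 : (0 < n)%N.
Proof. by have := finNzRing_gt1 F; rewrite cardF; case: (n). Qed.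

Lemma two_neq0 : 2%:R != 0 :> F.
Proof.
apply/negP=> /eqP two0; have := natr_card0 F.
rewrite cardF -natr1 (_ : 4 * n = 2 * (2 * n))%N; last by rewrite mulnA.
by rewrite natrM two0 mul0r add0r => /eqP; rewrite oner_eq0.
Qed.

Lemma neqN x : x != 0 -> x != - x.
Proof.
by move=> x0; rewrite -subr_eq0 opprK -mulr2n -mulr_natr mulf_neq0 ?two_neq0.
Qed.

(** A fifth n-th power would be a fifth root of X^4 - 1. *)
Lemma rainbow_class s x : rainbow s -> size s = 4%N -> x != 0 ->
  exists2 y, y \in s & x ^+ n = y ^+ n.
Proof.
case/andP=> s0 s_uniq size_s x0.
have [/mapP //|xs] := boolP (x ^+ n \in [seq y ^+ n | y <- s]).
have p0 : 'X^4 - 1 != 0 :> {poly F} by rewrite -size_poly_eq0 size_XnsubC.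
have rt y : y != 0 -> root ('X^4 - 1) (y ^+ n).
  by move=> y0; rewrite rootE !hornerE quartic_pow // subrr.
have rts : all (root ('X^4 - 1)) (x ^+ n :: [seq y ^+ n | y <- s]).
  rewrite /= rt //; apply/allP=> _ /mapP[y ys ->].
  by apply: rt; apply: contraNneq s0 => <-.
have := max_poly_roots p0 rts; rewrite [uniq _]/= xs s_uniq => /(_ isT).
by rewrite size_XnsubC //= size_map size_s.
Qed.

(** A choice of one element from each pair x, - x of fourth powers; the order of enumeration serves
    only to make the choice. *)
Definition half : pred F :=
  [pred x | (x ^+ n == 1) && (enum_rank x < enum_rank (- x))%N].

Lemma half_neq0 x : half x -> x != 0.
Proof.
case/andP=> x1 _; apply: contraTneq x1 => ->.
by rewrite expr0n gtn_eqF ?n_gt0 // eq_sym oner_eq0.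
Qed.

Lemma halfP x : x ^+ n = 1 -> exists b : bool, half (signed b x).
Proof.
move=> x1; have x0 : x != 0.
  apply: contra_eq_neq x1 => ->.
  by rewrite expr0n gtn_eqF ?n_gt0 // eq_sym oner_eq0.
have : enum_rank x != enum_rank (- x) by rewrite (inj_eq enum_rank_inj) neqN.
rewrite -val_eqE /= neq_ltn => /orP[lt|lt]; [exists false|exists true].
  by rewrite /half /= x1 eqxx.
by rewrite /half /= quarticN opprK x1 eqxx.
Qed.

Lemma half_opp x : half x -> half (- x) -> False.
Proof.
move=> /andP[_ lt] /andP[_]; rewrite opprK => gt.
by have := ltn_trans lt gt; rewrite ltnn.
Qed.

Lemma half_class x : half x -> x ^+ n = 1.
Proof. by case/andP=> /eqP. Qed.

Definition edge_index (e : edge) : nat :=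
  match e with e1 => 0 | e2 => 1 | e3 => 2 | e4 => 3 end.

Definition nth4 (s : seq F) (e : edge) : F := s`_(edge_index e).

(** The entries of [s] represent the four cosets, and each fourth power is, up to sign, a unique
    element of [half]. *)
Lemma rainbow_exact s : rainbow s -> size s = 4%N ->
  exact_on predT (fun k : {x | half x} * edge * bool =>
    signed k.2 (val k.1.1 * nth4 s k.1.2)).
Proof.
move=> rs size_s; have [s0 s_uniq] := andP rs.
have nth4_in e : nth4 s e \in s.
  by case: e; rewrite mem_nth // size_s.
have nth4_neq0 e : nth4 s e != 0 by apply: contraNneq s0 => <-.
have nth4_surj y : y \in s -> exists e, y = nth4 s e.
  move/(nthP 0)=> [i]; rewrite size_s; case: i => [|[|[|[|//]]]] _ <-;
  by [exists e1 | exists e2 | exists e3 | exists e4].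
have nth4_inj e e' : nth4 s e ^+ n = nth4 s e' ^+ n -> e = e'.
  have lt4 (a : edge) : (edge_index a < size [seq y ^+ n | y <- s])%N.
    by rewrite size_map size_s; case: a.
  have lt4' (a : edge) : (edge_index a < size s)%N by rewrite size_s; case: a.
  rewrite /nth4 -!(nth_map 0 0 (fun y => y ^+ n)) // => /eqP.
  by rewrite nth_uniq // => /eqP; case: e; case: e'.
have signed_pow b y : signed b y ^+ n = y ^+ n by case: b; rewrite //= quarticN.
split=> [[[[x hx] e] b] [[[x' hx'] e'] b'] /= eq_k|y].
  have ee : e = e'.
    apply: nth4_inj; move/(congr1 (fun y => y ^+ n)): eq_k.
    by rewrite !signed_pow !exprMn (half_class hx) (half_class hx') !mul1r.
  subst e'.
  have {}eq_k : signed b x = signed b' x'.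
    apply: (mulIf (nth4_neq0 e)).
    by case: b eq_k; case: b' => //=; rewrite -?mulNr.
  have [eb ex] : b = b' /\ x = x'.
    case: b b' eq_k => -[] //=; first by move/oppr_inj.
      by move=> ex; case: (@half_opp x); rewrite ?ex.
    by move=> ex; case: (@half_opp x'); rewrite -?ex.
  by subst b' x'; rewrite (bool_irrelevance hx hx').
rewrite andbT; split=> [y0|[[[[x hx] e] b] /= <-]]; last first.
  have: x * nth4 s e != 0 := mulf_neq0 (half_neq0 hx) (nth4_neq0 e).
  by case: b; rewrite //= oppr_eq0.
have [z zs yz] := rainbow_class rs size_s y0.
have [e ez] := nth4_surj z zs.
have [|b hb] := @halfP (y / z).
  rewrite expr_div_n yz divff // expf_neq0 // ez //.
exists (exist (fun x => half x) _ hb, e, b) => /=.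
have zz : y / z * z = y by rewrite divfK // ez.
by rewrite -ez; case: (b); rewrite /= ?mulNr zz ?opprK.
Qed.

Definition good_design a b c d (i : {x | half x}) (p : pos) : F :=
  val i * match p with pA => a | pB => b | pC => c | pD => d
                     | pE => - d | pF => - c | pG => - b | pH => - a end.

(** Since the two pairs consist of the negatives of a, b, c, d, the eight positions are the first
    list with both signs. Their differences c - d and a - b complete the lists for t = 0 and t =
    1. *)
Lemma good_has_design a b c d : good_quadruple a b c d -> @has_design F predT.
Proof.
case/and3P=> r1 r2 r3; exists {x | half x}; exists (good_design a b c d).
split=> [|[]].
- pose h (k : {x | half x} * pos) : {x | half x} * edge * bool :=
    match k.2 with
    | pA => (k.1, e1, false) | pB => (k.1, e2, false) | pC => (k.1, e3, false)
    | pD => (k.1, e4, false) | pE => (k.1, e4, true) | pF => (k.1, e3, true)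
    | pG => (k.1, e2, true) | pH => (k.1, e1, true) end.
  pose h' (k : {x | half x} * edge * bool) : {x | half x} * pos :=
    (k.1.1, match k.1.2, k.2 with
     | e1, false => pA | e2, false => pB | e3, false => pC | e4, false => pD
     | e1, true => pH | e2, true => pG | e3, true => pF | e4, true => pE end).
  apply: (exact_on_reindex (h := h) (h' := h')) (rainbow_exact r1 erefl).
  + by case=> i [].
  + by case=> [[i []] []].
  + by case=> i []; rewrite /good_design /= ?mulrN.
- apply: (exact_on_reindex (h := id) (h' := id)) (rainbow_exact r3 erefl) => //.
  by case=> [[i []] b']; rewrite /edge_diff /good_design /= -mulrBr ?opprK
    1?[- b + a]addrC.
apply: (exact_on_reindex (h := id) (h' := id)) (rainbow_exact r2 erefl) => //.
by case=> [[i []] b']; rewrite /edge_diff /good_design /= -mulrBr ?opprK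
  1?[- d + c]addrC.
Qed.

End Quartic.

(** * Large fields *)

(** A union bound: a, b, c, d are the sizes of four bad sets, e and f those of two partial unions, m
    that of the whole union. *)
Lemma four_bad_le (a b c d e f m w q : nat) :
  (2 * (a * w) <= 9 * q -> 2 * (b * w) <= 9 * q ->
   2 * (c * w) <= 9 * q -> 2 * (d * w) <= 9 * q ->
   e <= a + b -> f <= c + d -> m <= e + f -> 2 * (m * w) <= 36 * q)%N.
Proof.
move=> qa qb qc qd ab cd ef.
have : (m * w <= (a + b + c + d) * w)%N by rewrite leq_mul2r; lia.
by rewrite !mulnDl; lia.
Qed.

Section Large.

Variables (F : finFieldType) (n : nat).
Hypothesis cardF : #|F| = (4 * n).+1.
Hypothesis n_even : ~~ odd n.
Implicit Types (x y z g : F) (X Y : {set F}).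

Let n0 : (0 < n)%N := n_gt0 cardF.

Definition classes : {set F} := [set x ^+ n | x in predC1 0].

Definition class g : {set F} := [set x | x ^+ n == g].

(** The neighbours of [z] in [Y] along edges of colour [g]. A vertex z of [Y] is not its own
    neighbour in any colour, as the power 0 is not in [classes]. *)
Definition colored Y g z : {set F} := [set y in Y | (z - y) ^+ n == g].

Lemma pow_eq0 x : (x ^+ n == 0) = (x == 0).
Proof. by rewrite expf_eq0 n0. Qed.

Lemma classes_pow x : x != 0 -> x ^+ n \in classes.
Proof. by move=> x0; apply: imset_f. Qed.

Lemma classes_neq0 g : g \in classes -> g != 0.
Proof. by case/imsetP=> x x0 ->; rewrite pow_eq0. Qed.

Lemma classes1 : 1 \in classes.
Proof. by have := classes_pow (oner_neq0 F); rewrite expr1n. Qed.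

Lemma class_le g : (#|class g| <= n)%N.
Proof.
have p0 : 'X^n - g%:P != 0 by rewrite -size_poly_eq0 size_XnsubC.
have := max_poly_roots (rs := enum (class g)) p0.
rewrite enum_uniq -cardE size_XnsubC // ltnS; apply=> //.
by apply/allP=> x; rewrite mem_enum inE rootE !hornerE subr_eq0.
Qed.

Lemma card_classes_le : (#|classes| <= 4)%N.
Proof.
have p0 : 'X^4 - 1 != 0 :> {poly F} by rewrite -size_poly_eq0 size_XnsubC.
have := max_poly_roots (rs := enum classes) p0.
rewrite enum_uniq -cardE size_XnsubC // ltnS; apply=> //.
apply/allP=> y; rewrite mem_enum => /imsetP[x x0 ->].
by rewrite rootE !hornerE (quartic_pow cardF) // subrr.
Qed.

Lemma sum_class : (\sum_(g in classes) #|class g| = 4 * n)%N.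
Proof.
have <- : #|predC1 (0%R : F)| = (4 * n)%N by rewrite cardC1 cardF.
rewrite -sum1_card [RHS](partition_big (fun x => x ^+ n) (mem classes)) /=;
  last by move=> x; apply: classes_pow.
apply: eq_bigr => g gc; rewrite -sum1_card; apply: eq_bigl => x.
rewrite !inE -pow_eq0; have [->|_] := eqVneq (x ^+ n) g; rewrite ?andbF //.
by rewrite classes_neq0.
Qed.

(** At most four classes with at most n elements each hold the 4 n nonzero elements, so both bounds
    are attained. *)
Lemma card_classes : #|classes| = 4%N.
Proof.
apply/eqP; rewrite eqn_leq card_classes_le /= -(leq_pmul2r n0) -sum_class.
by rewrite -sum_nat_const leq_sum // => g _; apply: class_le.
Qed.

Lemma card_class g : g \in classes -> #|class g| = n.
Proof.
move=> gc; apply/eqP; rewrite eqn_leq class_le /=.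
have := sum_class; rewrite (bigD1 g) //=.
have : (\sum_(i in classes | i != g) #|class i| <= 3 * n)%N.
  apply: (@leq_trans (\sum_(i in classes | i != g) n)).
    by apply: leq_sum => i _; apply: class_le.
  rewrite sum_nat_const leq_mul2r; apply/orP; right.
  have <- : #|classes :\ g| = 3%N.
    by have := cardsD1 g classes; rewrite card_classes gc add1n => -[] <-.
  by rewrite subset_leq_card //; apply/subsetP=> i; rewrite !inE andbC.
by move: #|_| (\sum_(_ in _ | _) _)%N; lia.
Qed.

(* The map z |-> (z - y) / (z - y') sends these z into the n-th roots of unity
   other than 1. *)
Lemma same_class_le y y' : y != y' ->
  (#|[set z | (z - y) ^+ n == (z - y') ^+ n]| <= n.-1)%N.
Proof.
move=> ne; have <- : #|class 1 :\ 1| = n.-1.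
  have := cardsD1 1 (class 1); rewrite card_class ?classes1 // inE expr1n eqxx.
  by move->.
set A := [set z | _].
pose f z := (z - y) / (z - y').
have nz z : z \in A -> z - y' != 0.
  rewrite inE => /eqP eqz; apply/eqP=> z0; case/eqP: ne.
  move/eqP: eqz; rewrite z0 expr0n gtn_eqF //= pow_eq0 subr_eq0 => /eqP <-.
  by apply/eqP; rewrite -subr_eq0 z0.
have f_inj : {in A &, injective f}.
  move=> z z' /nz zy /nz zy' /eqP; rewrite eqr_div // => /eqP e.
  have : (z - z') * (y - y') = 0.
    have := subrr ((z - y) * (z' - y')); rewrite {2}e => <-; ring.
  by move/eqP; rewrite mulf_eq0 !subr_eq0 (negbTE ne) orbF => /eqP.
rewrite -(card_in_imset f_inj).
apply/subset_leq_card/subsetP=> _ /imsetP[z zP ->].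
have zy := nz z zP; move: zP; rewrite !inE => /eqP eqz.
rewrite expr_div_n eqz divff ?pow_eq0 // eqxx andbT.
apply: contra ne => /eqP e1; have : z - y = z - y'.
  by rewrite -[RHS]mul1r -e1 divfK.
by move/addrI/oppr_inj ->.
Qed.

Lemma card_colored Y g z :
  #|colored Y g z| = (\sum_(y in Y) ((z - y) ^+ n == g))%N.
Proof.
rewrite -sum1_card big_mkcond [RHS]big_mkcond /=.
by apply: eq_bigr => y _; rewrite inE; case: (y \in Y) => //=; case: eqP.
Qed.

Lemma sum_delta x : (\sum_(g in classes) (x ^+ n == g) = (x != 0%R))%N.
Proof.
have [->|x0] := eqVneq x 0.
  rewrite big1 // => g gc; rewrite expr0n gtn_eqF //=.
  by rewrite eq_sym (negbTE (classes_neq0 gc)).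
rewrite (bigD1 (x ^+ n)) ?classes_pow //= eqxx big1 ?addn0 // => g /andP[_].
by rewrite eq_sym => /negbTE->.
Qed.

Lemma sum_colored Y z :
  (\sum_(g in classes) #|colored Y g z| = \sum_(y in Y) (z != y))%N.
Proof.
under eq_bigr do rewrite card_colored.
rewrite exchange_big /=; apply: eq_bigr => y _.
by rewrite sum_delta subr_eq0.
Qed.

Lemma sum_all_colored Y :
  (\sum_z \sum_(g in classes) #|colored Y g z| = #|Y| * (4 * n))%N.
Proof.
under eq_bigr do rewrite sum_colored.
rewrite exchange_big /= -sum_nat_const; apply: eq_bigr => y _.
have <- : #|predC1 y| = (4 * n)%N by rewrite cardC1 cardF.
rewrite -sum1_card [RHS]big_mkcond; apply: eq_bigr => z _.
by rewrite !inE; case: eqP.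
Qed.

(** The squares count ordered pairs y, y' joined to z in the same colour. A pair y = y' contributes
    4 n, once for every z != y; any other pair at most n - 1 by [same_class_le]. *)
Lemma sum_sqr_colored Y :
  (\sum_z \sum_(g in classes) #|colored Y g z| ^ 2
    <= #|Y| * (4 * n) + #|Y| * (#|Y|.-1 * n.-1))%N.
Proof.
have -> : (\sum_z \sum_(g in classes) #|colored Y g z| ^ 2 =
    \sum_(y in Y) \sum_(y' in Y) \sum_z \sum_(g in classes)
      ((z - y) ^+ n == g) * ((z - y') ^+ n == g))%N.
  under eq_bigr => z _.
    under eq_bigr => g _ do rewrite card_colored expnS expn1 big_distrlr /=.
    rewrite exchange_big /=.
    under eq_bigr => y _ do rewrite exchange_big /=.
  over.
  rewrite exchange_big /=; apply: eq_bigr => y _.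
  by rewrite exchange_big.
rewrite -mulnDr -sum_nat_const; apply: leq_sum => y yY.
rewrite (bigD1 y) //=; apply: leq_add.
  have <- : #|predC1 y| = (4 * n)%N by rewrite cardC1 cardF.
  rewrite -sum1_card [X in (_ <= X)%N]big_mkcond; apply: leq_sum => z _.
  under eq_bigr => g _ do rewrite mulnb andbb.
  by rewrite sum_delta subr_eq0 inE; case: eqP.
apply: (@leq_trans (\sum_(y' in Y | y' != y) n.-1)).
  apply: leq_sum => y' /andP[_ ne]; rewrite eq_sym in ne.
  apply: leq_trans (same_class_le ne).
  rewrite -sum1_card [X in (_ <= X)%N]big_mkcond; apply: leq_sum => z _.
  rewrite inE; case: eqP => [->|ne_z].
    under eq_bigr => g _ do rewrite mulnb andbb.
    by rewrite sum_delta; case: eqP.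
  rewrite big1 // => g _; case: eqP => // <-; rewrite mul1n.
  by case: eqP => // /esym.
rewrite sum_nat_const leq_mul2r; apply/orP; right.
rewrite (cardsD1 y Y) yY /= subset_leq_card //.
by apply/subsetP=> i; rewrite !inE andbC.
Qed.

(** The sum of the squares (k N h - t)^2 is nonnegative; expanding it with the mixed terms moved to
    the other side avoids subtraction. *)
Lemma sqr_mean_le (A : {set F}) (N : F -> nat) k t :
  (2 * t * k * \sum_(h in A) N h
    <= k ^ 2 * \sum_(h in A) N h ^ 2 + #|A| * t ^ 2)%N.
Proof.
rewrite -sum_nat_const !big_distrr -big_split /=; apply: leq_sum => h _.
rewrite -expnMn.
by have := nat_Cauchy (k * N h) t; rewrite [(_ * t)%N]mulnC !mulnA => -[].
Qed.

(* Summed over all z and all classes, (4 #|colored Y g z| - #|Y|)^2 is at most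
   12 #|F| #|Y|; each z in D contributes at least 4/3 (#|Y| - 4 l)^2. *)
Lemma deficiency (Y D : {set F}) g l : g \in classes -> [disjoint D & Y] ->
    (forall z, z \in D -> #|colored Y g z| <= l)%N -> (4 * l <= #|Y|)%N ->
  (#|D| * (#|Y| - 4 * l) ^ 2 <= 9 * #|F| * #|Y|)%N.
Proof.
move=> gc dis small l_le; set y := #|Y| in l_le *.
pose N z h := #|colored Y h z|.
(* Three times the sum over h of (4 N z h - y)^2, expanded; the factor 3 clears the denominator of
   4/3. *)
have step z : (24 * y * \sum_(h in classes) N z h
      + (z \in D) * (4 * (y - 4 * l) ^ 2)
    <= 48 * \sum_(h in classes) N z h ^ 2 + 12 * y ^ 2)%N.
  have [zD|_] := boolP (z \in D); last first.
    have := sqr_mean_le classes (N z) 4 y; rewrite card_classes; lia.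
  have sumN : (\sum_(h in classes) N z h = y)%N.
    rewrite sum_colored /y -sum1_card; apply: eq_bigr => u uY.
    case: eqP => // zu; have := disjointFr dis zD.
    by rewrite zu uY.
  have card3 : #|classes :\ g| = 3%N.
    by have := cardsD1 g classes; rewrite card_classes gc add1n => -[] <-.
  (* What the class g lacks is spread over the other three, whose squared deviations add at least a
     third of that of g. *)
  have := sqr_mean_le (classes :\ g) (N z) 3 (y - N z g); rewrite card3.
  move: sumN; rewrite !(big_setD1 g gc) /=.
  have := small z zD; rewrite -/(N z g).
  move: (N z g) (\sum_(_ in _) _ ^ 2)%N (\sum_(_ in _) N z _)%N => a b2 b.
  move=> al sumN; have -> : (y - a = b)%N by lia.
  move=> b2b; have : (b ^ 2 <= 3 * b2)%N by nia.
  have : (y - 4 * l <= y - 4 * a)%N by lia.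
  rewrite -leq_sqr; nia.
have cardD : (#|D| = \sum_z (z \in D))%N.
  rewrite -sum1_card big_mkcond /=.
  by apply: eq_bigr => z _; case: (z \in D).
have : (24 * y * \sum_z \sum_(h in classes) N z h + #|D| * (4 * (y - 4 * l) ^ 2)
    <= 48 * \sum_z \sum_(h in classes) N z h ^ 2 + #|F| * (12 * y ^ 2))%N.
  rewrite cardD !big_distrr big_distrl -sum_nat_const -!big_split /=.
  by apply: leq_sum => z _; apply: step.
rewrite sum_all_colored; have := sum_sqr_colored Y; rewrite -/y -/N.
move: (\sum_z \sum_(h in _) _)%N #|D| => S d; rewrite cardF.
have [->|y0] := posnP y; first by rewrite sub0n exp0n // !muln0.
(* The terms in n y^2 cancel. What remains is 144 n y + 48 y - 36 y^2, which this bound brings below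
   36 #|F| y. *)
have : (y <= y * y)%N by rewrite leq_pmulr.
rewrite -(prednK n0) -(prednK y0) /= -(mulnn y.-1.+1).
move: n.-1 y.-1 ((_ - _) ^ 2)%N => m x u; lia.
Qed.

Lemma disjoint_class (A B : {set F}) u v : u != v ->
  A \subset class u -> B \subset class v -> [disjoint A & B].
Proof.
move=> uv Au Bv; apply/pred0Pn => -[x /andP[/(subsetP Au) + /(subsetP Bv)]].
by rewrite !inE => /eqP -> /eqP e; rewrite e eqxx in uv.
Qed.

(** Division by a fourth power z preserves cosets and moves z to 1. If the set were small, every z
    in [class 1] would therefore see few elements of [class u] in colour s, and n such z are more
    than [deficiency] permits. *)
Lemma card_two_color u s w : u \in classes -> s \in classes -> u != 1 ->
    (0 < w)%N -> (32 * w <= n)%N -> (9 * #|F| < (n - 4 * (8 * w).-1) ^ 2)%N ->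
  (8 * w <= #|[set x in class u | (x - 1) ^+ n == s]|)%N.
Proof.
move=> uc sc u1 w0 wn big; rewrite leqNgt; apply/negP=> small.
have dis : [disjoint class 1 & class u].
  by apply: (@disjoint_class _ _ 1 u) => //; rewrite eq_sym.
have := @deficiency (class u) (class 1) s (8 * w).-1 sc dis.
rewrite !card_class ?classes1 // => H.
have : (n * (n - 4 * (8 * w).-1) ^ 2 <= 9 * #|F| * n)%N.
  apply: H; last by lia.
  move=> z; rewrite inE => /eqP z1.
  have z0 : z != 0 by rewrite -pow_eq0 z1 oner_neq0.
  apply: leq_trans (_ : (#|[set x in class u | (x - 1) ^+ n == s]| <= _)%N);
    last by lia.
  rewrite -(card_imset _ (mulIf (invr_neq0 z0))).
  apply/subset_leq_card/subsetP=> _ /imsetP[y + ->].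
  rewrite !inE => /andP[/eqP yu /eqP ys].
  rewrite expr_div_n yu z1 divr1 eqxx /=.
  rewrite -[X in _ - X](divff z0) -mulrBl expr_div_n z1 divr1.
  by rewrite -(quarticN n_even) opprB ys.
by rewrite mulnC leq_pmul2r // leqNgt big.
Qed.

(** An even split gives z a share of 2 w in [U]. Falling below half of it makes 8 w - 4 (w - 1) at
    least 4 w in [deficiency]. *)
Lemma card_bad (U Z : {set F}) s w : s \in classes -> [disjoint Z & U] ->
    (0 < w)%N -> #|U| = (8 * w)%N ->
  (2 * (#|[set z in Z | (#|colored U s z| < w)%N]| * w) <= 9 * #|F|)%N.
Proof.
move=> sc dis w0 cardU; set D := [set z in Z | _].
have disD : [disjoint D & U].
  by apply: disjointWl dis; apply/subsetP=> z; rewrite inE => /andP[].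
have := @deficiency U D s w.-1 sc disD; rewrite cardU => H.
have : (#|D| * (8 * w - 4 * w.-1) ^ 2 <= 9 * #|F| * (8 * w))%N.
  apply: H; last by lia.
  by move=> z; rewrite inE => /andP[_]; lia.
have : ((4 * w) ^ 2 <= (8 * w - 4 * w.-1) ^ 2)%N by rewrite leq_sqr; lia.
move: ((8 * w - 4 * w.-1) ^ 2)%N #|D| #|F| => r d q r_ge dr.
have : (d * (16 * (w * w)) <= 9 * q * (8 * w))%N.
  apply: leq_trans dr; rewrite leq_mul2l; apply/orP; right.
  by apply: leq_trans r_ge; rewrite expnMn -!mulnn.
rewrite [X in (X <= _)%N](_ : _ = (8 * w) * (2 * (d * w)))%N; last by lia.
by rewrite [X in (_ <= X)%N]mulnC leq_pmul2l // muln_gt0.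
Qed.

(** Without such an edge every x in [X] would have no neighbour of colour k in [Y], the extreme case
    l = 0 of [deficiency]. *)
Lemma edge_of_color (X Y : {set F}) k : k \in classes -> [disjoint X & Y] ->
    (9 * #|F| < #|X| * #|Y|)%N ->
  exists x y, [/\ x \in X, y \in Y & (x - y) ^+ n = k].
Proof.
move=> kc dis big.
have [/existsP[x /andP[xX /existsP[y /andP[yY /eqP e]]]]|no] :=
  boolP [exists x, (x \in X) && [exists y, (y \in Y) && ((x - y) ^+ n == k)]].
  by exists x, y.
have := @deficiency Y X k 0 kc dis; rewrite muln0 subn0 => /(_ _ isT) H.
have : (#|X| * #|Y| ^ 2 <= 9 * #|F| * #|Y|)%N.
  apply: H => x xX; rewrite leqn0 cards_eq0; apply/eqP/setP=> y.
  rewrite !inE; apply: contraNF no => /andP[yY e].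
  by apply/existsP; exists x; rewrite xX; apply/existsP; exists y; rewrite yY.
rewrite -mulnn mulnA leq_mul2r leqNgt big orbF => /eqP Y0.
by rewrite Y0 muln0 in big.
Qed.

Lemma two_color_union (U U' : {set F}) s t z w : [disjoint U & U'] ->
  (w <= #|colored U t z|)%N -> (w <= #|colored U' s z|)%N ->
  (2 * w <= #|colored U t z :|: colored U' s z|)%N.
Proof.
move=> dis h h'; rewrite cardsU (_ : _ :&: _ = set0) ?cards0; first by lia.
apply/setP=> x; rewrite !inE; apply/negP=> /andP[/andP[xU _] /andP[xU' _]].
by rewrite (disjointFr dis xU) in xU'.
Qed.

Lemma subset_of_card (U : {set F}) m : (m <= #|U|)%N ->
  exists2 V : {set F}, V \subset U & #|V| = m.
Proof.
move=> mU; exists [set x in take m (enum U)].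
  by apply/subsetP=> x; rewrite inE => /mem_take; rewrite mem_enum.
by rewrite cardsE (card_uniqP _) ?take_uniq ?enum_uniq // size_takel // -cardE.
Qed.

Lemma classes_list : exists k1 k2 k3, [/\ k1 \in classes, k2 \in classes,
  k3 \in classes & uniq [:: 1; k1; k2; k3]].
Proof.
have : size (enum (classes :\ 1)) = 3%N.
  rewrite -cardE; have := cardsD1 1 classes.
  by rewrite card_classes classes1 add1n => -[] <-.
have := enum_uniq (classes :\ 1); have := mem_enum (classes :\ 1).
case: (enum _) => [|k1 [|k2 [|k3 []]]] // memE uk _; exists k1, k2, k3.
have mem k : k \in [:: k1; k2; k3] -> k \in classes /\ k != 1.
  by rewrite memE !inE => /andP[].
have [c1 n1] := mem k1 ltac:(by rewrite !inE eqxx).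
have [c2 n2] := mem k2 ltac:(by rewrite !inE eqxx orbT).
have [c3 n3] := mem k3 ltac:(by rewrite !inE eqxx !orbT).
split=> //; rewrite cons_uniq uk andbT !inE !negb_or.
by rewrite ![1 == _]eq_sym n1 n2 n3.
Qed.

Lemma rainbow_of_pow (s ks : seq F) : [seq x ^+ n | x <- s] = ks ->
  {subset ks <= classes} -> uniq ks -> rainbow n s.
Proof.
move=> <- sub us; rewrite /rainbow us andbT; apply/negP=> s0.
have /sub/classes_neq0 : 0 ^+ n \in [seq x ^+ n | x <- s] by apply: map_f.
by rewrite pow_eq0 eqxx.
Qed.

(* In the quadruple (1, z, c, d) the classes of 1, z, c, d are 1, k1, k2, k3,
   those of 1 - z and c - d are 1 and k1, and c, d each have differences of
   classes k2 and k3, in either order, with 1 and z. *)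
Lemma good_of_large : (105 * 100 <= n)%N ->
  exists a b c d : F, good_quadruple n a b c d.
Proof.
move=> n_ge; have [k1 [k2 [k3 [c1 c2 c3 uk]]]] := classes_list.
(* With w about n / 34, both (2 w)^2 and (n - 32 w)^2 exceed 9 #|F|. *)
have [w [w_lo w_hi]] : exists w, (34 * w <= n)%N /\ (n < 34 * w + 34)%N.
  by exists (n %/ 34)%N; split; lia.
have w308 : (308 <= w)%N by lia.
have [w0 wn] : (0 < w)%N /\ (32 * w <= n)%N by split; lia.
have w2 : (9 * #|F| < (2 * w) * (2 * w))%N by rewrite cardF; nia.
have big : (9 * #|F| < (n - 4 * (8 * w).-1) ^ 2)%N.
  by apply: leq_trans w2 _; rewrite mulnn leq_sqr; lia.
have [p1 p2 p3] : [/\ k1 != 1, k2 != 1 & k3 != 1].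
  move: uk; rewrite /= !inE !negb_or ![_ == 1]eq_sym.
  by case/and3P=> /and3P[-> -> ->].
have [ne12 ne13 ne32] : [/\ k1 != k2, k1 != k3 & k2 != k3].
  by move: uk; rewrite /= !inE !negb_or => /and4P[_ /andP[-> ->] -> _].
pose U u s := [set x in class u | (x - 1) ^+ n == s].
have sU u s : U u s \subset class u by apply/subsetP=> x; rewrite inE => /andP[].
have cardU u s : u \in classes -> s \in classes -> u != 1 ->
    (8 * w <= #|U u s|)%N.
  by move=> uc sc u1; apply: card_two_color.
have sub_U u s : u \in classes -> s \in classes -> u != 1 ->
    exists V : {set F}, V \subset U u s /\ #|V| = (8 * w)%N.
  by move=> uc sc /(cardU u s uc sc)/subset_of_card[V VU cardV]; exists V.
have [V22 [s22 v22]] := sub_U k2 k2 c2 c2 p2.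
have [V23 [s23 v23]] := sub_U k2 k3 c2 c3 p2.
have [V32 [s32 v32]] := sub_U k3 k2 c3 c2 p3.
have [V33 [s33 v33]] := sub_U k3 k3 c3 c3 p3.
have disZ u s (V : {set F}) : k1 != u -> V \subset U u s -> [disjoint U k1 1 & V].
  by move=> ne VU; apply: disjoint_class ne (sU _ _) (subset_trans VU (sU _ _)).
have b22 := card_bad c3 (disZ _ _ _ ne12 s22) w0 v22.
have b23 := card_bad c2 (disZ _ _ _ ne12 s23) w0 v23.
have b32 := card_bad c3 (disZ _ _ _ ne13 s32) w0 v32.
have b33 := card_bad c2 (disZ _ _ _ ne13 s33) w0 v33.
(* Elements of [V22] differ from 1 by class k2, so they should differ from z by class k3; the other
   three sets are matched with k2 or k3 by the same rule. *)
pose bad (V : {set F}) s := [set z in U k1 1 | (#|colored V s z| < w)%N].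
(* The four bad sets have at most 18 #|F| / w elements together, which [w2] makes less than 8 w. *)
have [z zU] : exists z, z \in U k1 1 :\:
    (bad V22 k3 :|: bad V23 k2 :|: (bad V32 k3 :|: bad V33 k2)).
  apply/set0Pn; rewrite -cards_eq0 -lt0n cardsD subn_gt0.
  apply: leq_ltn_trans (subset_leq_card (subsetIr _ _)) _.
  apply: leq_trans (cardU k1 1 c1 classes1 p1).
  rewrite -(ltn_pmul2r w0) -(ltn_pmul2l (isT : 0 < 2)%N).
  apply: leq_ltn_trans (_ : (36 * #|F| < _)%N); last first.
    by move: w2; clear; move: #|F| => q; lia.
  move: b22 b23 b32 b33; rewrite -/(bad V22 k3) -/(bad V23 k2).
  rewrite -/(bad V32 k3) -/(bad V33 k2) => b22 b23 b32 b33.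
  have le (A B : {set F}) : (#|A :|: B| <= #|A| + #|B|)%N.
    by rewrite cardsU leq_subr.
  have l1 := le (bad V22 k3) (bad V23 k2).
  have l2 := le (bad V32 k3) (bad V33 k2).
  have l3 := le (bad V22 k3 :|: bad V23 k2) (bad V32 k3 :|: bad V33 k2).
  exact: four_bad_le b22 b23 b32 b33 l1 l2 l3.
move: zU; rewrite !in_setD !in_setU !negb_or -!andbA.
case/and5P=> z22 z23 z32 z33 zU.
have good_z V s : z \notin bad V s -> (w <= #|colored V s z|)%N.
  by rewrite inE zU /= -leqNgt.
have dis_colors u s s' (V V' : {set F}) : s != s' -> V \subset U u s ->
    V' \subset U u s' -> [disjoint V & V'].
  move=> ss /subsetP VU /subsetP VU'; apply/pred0Pn=> -[x /andP[/VU + /VU']].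
  rewrite !inE => /andP[_ /eqP e1] /andP[_ /eqP e2].
  by rewrite -e1 -e2 eqxx in ss.
(* There are at least 2 w candidates for c, of class k2, and as many for d, of class k3; by [w2]
   some edge between them has colour k1. *)
have X2 := two_color_union (dis_colors _ _ _ _ _ ne32 s22 s23) (good_z _ _ z22)
  (good_z _ _ z23).
have Y2 := two_color_union (dis_colors _ _ _ _ _ ne32 s32 s33) (good_z _ _ z32)
  (good_z _ _ z33).
move: X2 Y2; set X := _ :|: _; set Y := _ :|: _ => X2 Y2.
have XP u (V V' : {set F}) x : V \subset U u k2 -> V' \subset U u k3 ->
    x \in colored V k3 z :|: colored V' k2 z ->
  x ^+ n = u /\ ((x - 1) ^+ n = k2 /\ (z - x) ^+ n = k3 \/
                 (x - 1) ^+ n = k3 /\ (z - x) ^+ n = k2).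
  move=> /subsetP VU /subsetP VU'; rewrite !inE.
  case/orP=> /andP[]; [move/VU | move/VU']; rewrite !inE.
    by case/andP=> /eqP-> /eqP-> /eqP->; split; [|left].
  by case/andP=> /eqP-> /eqP-> /eqP->; split; [|right].
have disXY : [disjoint X & Y].
  apply/pred0Pn=> -[x /andP[]].
  move=> /(XP k2 _ _ _ s22 s23)[e _] /(XP k3 _ _ _ s32 s33)[e' _].
  by rewrite -e -e' eqxx in ne32.
have [|c [d [cX dY cd]]] := edge_of_color c1 disXY.
  by apply: leq_trans w2 _; apply: leq_mul.
have [pc c'] := XP k2 _ _ _ s22 s23 cX.
have [pd d'] := XP k3 _ _ _ s32 s33 dY.
have [pz pz1] : z ^+ n = k1 /\ (z - 1) ^+ n = 1.
  by move: zU; rewrite !inE => /andP[/eqP-> /eqP->].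
have sym x y : (x - y) ^+ n = (y - x) ^+ n by rewrite -opprB quarticN.
pose neq := (negbTE p1, negbTE p2, negbTE p3, negbTE ne12, negbTE ne13,
  negbTE ne32).
have neq' := (eq_sym 1 k1, eq_sym 1 k2, eq_sym 1 k3, eq_sym k2 k1, eq_sym k3 k1,
  eq_sym k3 k2).
have rb (s ks : seq F) : [seq x ^+ n | x <- s] = ks ->
    all (mem [:: 1; k1; k2; k3]) ks -> uniq ks -> rainbow n s.
  move=> es /allP sub; apply: rainbow_of_pow es _ => k /sub; rewrite !inE.
  by case/or4P=> /eqP->; rewrite ?classes1.
exists 1, z, c, d; apply/and3P; split.
- apply: (@rb _ [:: 1; k1; k2; k3]) => //=; first by rewrite expr1n pz pc pd.
  by rewrite !inE !eqxx !orbT.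
- case: c' => -[e1 e2].
    apply: (@rb _ [:: 1; k3; k2; k1]); first by rewrite /= sym pz1 e2 e1 cd.
      by rewrite /= !inE !eqxx !orbT.
    by rewrite /= !inE ?neq' ?neq.
  apply: (@rb _ [:: 1; k2; k3; k1]); first by rewrite /= sym pz1 e2 e1 cd.
    by rewrite /= !inE !eqxx !orbT.
  by rewrite /= !inE ?neq' ?neq.
case: d' => -[e1 e2].
  apply: (@rb _ [:: k2; k3; k1; 1]).
  - by rewrite /= sym e1 e2 cd sym pz1.
  - by rewrite /= !inE !eqxx !orbT.
  by rewrite /= !inE ?neq' ?neq.
apply: (@rb _ [:: k3; k2; k1; 1]).
- by rewrite /= sym e1 e2 cd sym pz1.
- by rewrite /= !inE !eqxx !orbT.
by rewrite /= !inE ?neq' ?neq.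
Qed.

End Large.

(** * Small fields *)

Lemma to_nat_gt0 n : (0 < Pos.to_nat n)%N.
Proof. by apply/ssrnat.ltP; apply: Pos2Nat.is_pos. Qed.

(** * Verification of quadruples over an abstract arithmetic *)

Section Checker.

Variables (T : Type) (mul sub : T -> T -> T) (eqt : T -> T -> bool) (one : T).

Fixpoint pow (x : T) (n : positive) : T := match n with
  | xH => x
  | xO m => let y := pow x m in mul y y
  | xI m => let y := pow x m in mul (mul y y) x
  end.

(** Only equalities are tested: if 1, -1, i, - i all occur among four powers, these are distinct.
    Thus soundness of [eqt] suffices, and an element may have several representations. *)
Definition check_rainbow (n : positive) (i : T) (s : seq T) :=
  let t := [seq pow x n | x <- s] in
  let m1 := sub (sub one one) one in
  all (fun v => has (eqt v) t) [:: one; m1; i; sub (sub one one) i].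

(** For a = 1 in a good quadruple, the n-th power of b is -1 or a square root of -1; in the former
    case that of c is such a root. The test on i * i confirms the choice. *)
Definition check_good (n : positive) (a b c d : T) :=
  let m1 := sub (sub one one) one in
  let i := if eqt (pow b n) m1 then pow c n else pow b n in
  [&& eqt (mul i i) m1, check_rainbow n i [:: a; b; c; d],
    check_rainbow n i [:: sub a b; sub b c; sub c a; sub c d] &
    check_rainbow n i [:: sub a d; sub b d; sub c d; sub a b]].

Variables (F : finFieldType) (ev : T -> F).
Hypothesis evM : forall x y, ev (mul x y) = ev x * ev y.
Hypothesis evB : forall x y, ev (sub x y) = ev x - ev y.
Hypothesis ev1 : ev one = 1.
Hypothesis evE : forall x y, eqt x y -> ev x = ev y.

Lemma ev_pow x n : ev (pow x n) = ev x ^+ Pos.to_nat n.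
Proof.
elim: n => [n IH|n IH|] /=; last by [].
  by rewrite !evM IH Pos2Nat.inj_xI multE exprS mulrC mulnC exprM expr2.
by rewrite evM IH Pos2Nat.inj_xO multE mulnC exprM expr2.
Qed.

Hypothesis two0 : 2%:R != 0 :> F.

(** The four roots are distinct because 2 is nonzero, and a list of length 4 that contains them all
    has no repetition. *)
Lemma check_rainbowP n i s : ev i ^+ 2 = -1 ->
  check_rainbow n i s -> size s = 4%N ->
  rainbow (Pos.to_nat n) [seq ev x | x <- s].
Proof.
move=> i2 chk size_s; set j := ev i in i2.
have j0 : j != 0.
  by apply: contra_eq_neq i2 => ->; rewrite expr0n eq_sym oppr_eq0 oner_eq0.
have NN (x : F) : x != 0 -> x != - x.
  by move=> x0; rewrite -subr_eq0 opprK -mulr2n -mulr_natr mulf_neq0.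
have j1 : j != 1.
  by apply: contra_eq_neq i2 => ->; rewrite expr1n NN ?oner_neq0.
have j_1 : j != -1.
  by apply: contra_eq_neq i2 => ->; rewrite sqrrN expr1n NN ?oner_neq0.
pose V := [:: 1; -1; j; - j].
have uV : uniq V.
  have jN : - j != 1 by rewrite eqr_oppLR.
  have NjN : - j != -1 by rewrite eqr_opp.
  rewrite /= !inE !negb_or ![1 == _]eq_sym ![-1 == _]eq_sym j1 j_1 jN NjN.
  by rewrite !NN ?oner_neq0.
pose W := [seq x ^+ Pos.to_nat n | x <- [seq ev x | x <- s]].
have sub_VW : {subset V <= W}.
  have in_W v : has (eqt v) [seq pow x n | x <- s] -> ev v \in W.
    rewrite /W; elim: (s) => //= x s' IH /orP[/evE->|/IH].
      by rewrite ev_pow inE eqxx.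
    by rewrite inE orbC => ->.
  move: chk => /= /and5P[/in_W w1 /in_W w2 /in_W w3 /in_W w4 _] y.
  rewrite !evB ev1 subrr !sub0r -/j in w1 w2 w3 w4.
  by rewrite !inE => /or4P[] /eqP->.
have size_W : size W = 4%N by rewrite !size_map.
have [_ eqVW] : (size V = size W) * (V =i W).
  by apply: uniq_min_size; rewrite ?size_W.
have uW : uniq W by rewrite (uniq_size_uniq uV eqVW) size_W.
apply/andP; split=> //; apply/negP=> s0.
have : 0 ^+ Pos.to_nat n \in V by rewrite eqVW; apply: map_f.
have -> : 0 ^+ Pos.to_nat n = 0 :> F.
  by rewrite expr0n gtn_eqF ?to_nat_gt0.
by rewrite !inE !(eq_sym 0) !oppr_eq0 oner_eq0 (negbTE j0).
Qed.

Lemma check_goodP n a b c d : check_good n a b c d ->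
  good_quadruple (Pos.to_nat n) (ev a) (ev b) (ev c) (ev d).
Proof.
case/and4P; set i := if _ then _ else _.
move/evE; rewrite evM -expr2 !evB ev1 subrr sub0r => i2.
move=> chk1 chk2 chk3; have r1 := check_rainbowP i2 chk1 erefl.
have r2 := check_rainbowP i2 chk2 erefl; have r3 := check_rainbowP i2 chk3 erefl.
apply/and3P.
by move: r1 r2 r3; rewrite /= !evB.
Qed.

End Checker.

(** * Arithmetic modulo p on binary numbers *)

Section BinaryEval.

Variables (A : comNzRingType) (p : N).
Hypothesis p0 : (N.to_nat p)%:R = 0 :> A.

Definition evN (x : N) : A := (N.to_nat x)%:R.

Lemma evND x y : evN (x + y) = evN x + evN y.
Proof. by rewrite /evN N2Nat.inj_add natrD. Qed.

Lemma evNM x y : evN (x * y) = evN x * evN y.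
Proof. by rewrite /evN N2Nat.inj_mul natrM. Qed.

Lemma evN_mod x : evN (x mod p) = evN x.
Proof.
by rewrite [in RHS](N.Div0.div_mod x p) evND evNM [evN p]p0 mul0r add0r.
Qed.

Lemma evN_pred : p <> 0%num -> evN (p - 1) = -1.
Proof.
move=> pn0; apply/eqP; rewrite -addr_eq0 -[1]/(evN 1) -evND N.sub_add.
  by apply/eqP.
by lia.
Qed.

Definition mulN x y := ((x * y) mod p)%num.
(* The factor p - 1 stands for -1: subtraction on N is truncated. *)
Definition subN x y := ((x + (p - 1) * y) mod p)%num.

Lemma evN_mul x y : evN (mulN x y) = evN x * evN y.
Proof. by rewrite evN_mod evNM. Qed.

Lemma evN_sub x y : p <> 0%num -> evN (subN x y) = evN x - evN y.
Proof. by move=> pn0; rewrite evN_mod evND evNM evN_pred // mulN1r. Qed.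

End BinaryEval.

(* Residues modulo p and X^k - r, as lists of coefficients in increasing
   degree. *)
Section Lists.

Variables (p : N) (k : nat) (r : seq N).

Fixpoint addL (x y : seq N) := match x, y with
  | [::], _ => y
  | _, [::] => x
  | a :: x, b :: y => ((a + b) mod p)%num :: addL x y
  end.

Definition scaleL c (x : seq N) := [seq ((c * a) mod p)%num | a <- x].

(** Multiplication by X, where a coefficient c that reaches degree k is replaced by c times r. *)
Definition mulxL (x : seq N) :=
  let y := 0%num :: x in
  if drop k y is [:: c] then addL (take k y) (scaleL c r) else y.

Definition mulL (x y : seq N) :=
  foldr (fun a z => addL (scaleL a y) (mulxL z)) [::] x.

Definition subL (x y : seq N) := addL x (scaleL (p - 1) y).

Definition eqL (x y : seq N) := all (N.eqb 0) (subL x y).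

Variables (A : comNzRingType) (w : A).
Hypothesis p0 : (N.to_nat p)%:R = 0 :> A.
Hypothesis pn0 : p <> 0%num.

Definition evL (x : seq N) : A := foldr (fun a z => evN A a + w * z) 0 x.

Lemma evL_add x y : evL (addL x y) = evL x + evL y.
Proof.
elim: x y => [|a x IH] [|b y] /=; rewrite ?add0r ?addr0 //.
by rewrite IH evN_mod // evND mulrDr addrACA.
Qed.

Lemma evL_scale c x : evL (scaleL c x) = evN A c * evL x.
Proof.
elim: x => [|a x IH] /=; first by rewrite mulr0.
by rewrite IH evN_mod // evNM mulrDr mulrCA.
Qed.

Lemma evL_cat x y : evL (x ++ y) = evL x + w ^+ size x * evL y.
Proof.
elim: x => [|a x IH] /=; first by rewrite add0r mul1r.
by rewrite IH mulrDr addrA exprS mulrA.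
Qed.

Lemma evL_sub x y : evL (subL x y) = evL x - evL y.
Proof. by rewrite evL_add evL_scale evN_pred // mulN1r. Qed.

Lemma evL_eq x y : eqL x y -> evL x = evL y.
Proof.
move=> exy; apply/eqP; rewrite -subr_eq0 -evL_sub; move: exy; rewrite /eqL.
elim: (subL x y) => //= -[|//] z IH /IH/eqP->.
by rewrite mulr0 addr0.
Qed.

(** The error term is kept for arbitrary [w]: it vanishes at a root in the field, and at 'X it
    expresses a congruence modulo X^k - r. *)
Lemma evL_mulx x : exists t, evL (mulxL x) = w * evL x + (w ^+ k - evL r) * t.
Proof.
have e0 : evL (0%num :: x) = w * evL x by rewrite /= add0r.
rewrite /mulxL -e0; case e: (drop _ _) => [|c [|? ?]];
  [by exists 0; rewrite mulr0 addr0 | | by exists 0; rewrite mulr0 addr0].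
exists (- evN A c); rewrite evL_add evL_scale -{2}(cat_take_drop k (0%num :: x)).
rewrite evL_cat e /= mulr0 addr0 size_takel; first by ring.
by rewrite leqNgt; apply/negP => /ltnW/drop_oversize; rewrite e.
Qed.

Lemma evL_mul x y :
  exists t, evL (mulL x y) = evL x * evL y + (w ^+ k - evL r) * t.
Proof.
elim: x => [|a x [t IH]] /=; first by exists 0; rewrite mul0r mulr0 addr0.
have [u eu] := evL_mulx (mulL x y).
by exists (w * t + u); rewrite evL_add evL_scale eu IH; ring.
Qed.

Lemma evL_mul_root x y : w ^+ k = evL r -> evL (mulL x y) = evL x * evL y.
Proof. by have [t ->] := evL_mul x y; move->; rewrite subrr mul0r addr0. Qed.

End Lists.

(* The checked identity makes X^k - r divide X^q - X, the product of all X - a. *)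
Lemma check_root (F : finFieldType) (p : N) (k : nat) (r : seq N) (q : positive) :
    (N.to_nat p)%:R = 0 :> F -> p <> 0%num -> (size r <= k)%N -> (0 < k)%N ->
    #|F| = Pos.to_nat q ->
    eqL p (pow (mulL p k r) [:: 0%num; 1%num] q) [:: 0%num; 1%num] ->
  exists w : F, w ^+ k = evL w r.
Proof.
move=> p0 pn0 size_r k0 cardF chk.
have p0X : (N.to_nat p)%:R = 0 :> {poly F} by rewrite -polyC_natr p0.
pose f : {poly F} := 'X^k - evL 'X r.
have size_ev s : (size (evL 'X s : {poly F}) <= size s)%N.
  elim: s => [|a s IH] /=; first by rewrite size_poly0.
  apply: leq_trans (size_polyD _ _) _; rewrite geq_max; apply/andP; split.
    by rewrite /evN -polyC_natr (leq_trans (size_polyC_leq1 _)).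
  by rewrite (leq_trans (size_polyMleq _ _)) // size_polyX add2n.
have size_f : size f = k.+1.
  rewrite size_polyDl ?size_polyXn // size_polyN ltnS.
  exact: leq_trans (size_ev r) size_r.
have evX : evL 'X [:: 0%num; 1%num] = 'X :> {poly F}.
  by rewrite /= /evN /= mulr0 addr0 mulr1 add0r.
have pow_dvd n :
    f %| evL 'X (pow (mulL p k r) [:: 0%num; 1%num] n) - 'X ^+ Pos.to_nat n.
  have mul_dvd x y a b : f %| evL 'X x - a -> f %| evL 'X y - b ->
      f %| evL 'X (mulL p k r x y) - a * b.
    move=> fx fy; have [t ->] := @evL_mul p k r _ 'X p0X x y.
    rewrite -/f (_ : _ - _ =
        (evL 'X x - a) * evL 'X y + a * (evL 'X y - b) + f * t); last by ring.
    apply: dvdp_add; last exact: dvdp_mulr.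
    by apply: dvdp_add; [apply: dvdp_mulr | apply: dvdp_mull].
  have fX : f %| evL 'X [:: 0%num; 1%num] - 'X by rewrite evX subrr dvdp0.
  elim: n => [n IH|n IH|]; last exact: fX.
    rewrite Pos2Nat.inj_xI multE exprSr mulnC exprM expr2.
    exact: (mul_dvd _ _ _ _ (mul_dvd _ _ _ _ IH IH) fX).
  rewrite Pos2Nat.inj_xO multE mulnC exprM expr2.
  exact: (mul_dvd _ _ _ _ IH IH).
have := pow_dvd q; rewrite -cardF (evL_eq 'X p0X pn0 chk) evX -opprB dvdpNr.
rewrite finField_genPoly -(big_map id xpredT (fun x => 'X - x%:P)).
(* A divisor of a product of distinct X - a is, up to a constant, a partial product; degree k > 0
   supplies a factor and so a root. *)
case/dvdp_prod_XsubC=> m; case: (mask _ _) => [|w s] fm.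
  move/eqp_size: fm; rewrite size_f big_nil size_poly1 => -[k_0].
  by rewrite k_0 in k0.
exists w; apply/eqP; have : root f w.
  by rewrite (eqp_root fm) root_prod_XsubC mem_head.
rewrite rootE !hornerE /= subr_eq0 => /eqP ->; apply/eqP.
have horner_ev s' : (evL 'X s').[w] = evL w s'.
  by elim: s' => [|a s' IH] /=; rewrite !hornerE ?IH // /evN -polyC_natr hornerC.
by rewrite horner_ev.
Qed.

(* An entry (q, b, c, d) gives the quadruple (1, b, c, d) modulo the prime q. *)
Definition prime_witnesses : seq (N * N * N * N) := [::
  (41,17,20,28); (73,12,5,11); (89,14,17,26); (97,8,5,10); (113,17,11,20);
  (137,5,7,10); (193,18,10,15); (233,28,3,27); (241,12,7,21); (257,21,3,10);
  (281,9,6,21); (313,15,2,17); (337,12,11,17); (353,15,5,14); (401,6,3,9);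
  (409,23,14,22); (433,11,7,14); (449,6,3,9); (457,12,10,20); (521,8,3,6);
  (569,6,3,9); (577,30,13,34); (593,10,6,17); (601,30,19,29); (617,22,6,17);
  (641,7,3,6); (673,22,6,17); (761,6,3,9); (769,18,11,22); (809,12,17,20);
  (857,7,6,8); (881,5,12,15); (929,6,3,9); (937,41,10,38); (953,8,3,6);
  (977,12,6,7); (1009,23,5,22); (1033,24,10,15); (1049,5,12,15);
  (1097,18,6,7); (1129,18,13,26); (1153,15,5,11); (1193,14,6,9);
  (1201,31,5,34); (1217,10,6,18); (1249,12,14,21); (1289,11,12,18);
  (1297,18,10,20); (1321,8,7,26); (1361,8,3,6); (1409,13,3,9);
  (1433,11,5,14); (1481,20,15,21); (1489,14,7,18); (1553,5,18,27);
  (1601,34,6,18); (1609,24,21,28); (1657,14,6,7); (1697,14,2,24);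
  (1721,15,7,18); (1753,15,3,13); (1777,5,12,15); (1801,30,19,39);
  (1873,18,10,20); (1889,38,9,37); (1913,14,6,13); (1993,21,13,20);
  (2017,20,2,17); (2081,6,3,9); (2089,12,14,21); (2113,15,5,11);
  (2129,12,9,27); (2137,21,10,20); (2153,3,13,14); (2161,22,21,28);
  (2273,10,29,30); (2281,42,6,34); (2297,10,5,15); (2377,2,15,20);
  (2393,14,6,13); (2417,8,3,6); (2441,18,22,34); (2473,38,25,35);
  (2521,20,22,33); (2593,23,10,47); (2609,8,3,6); (2617,15,7,18);
  (2633,8,3,6); (2657,26,5,18); (2689,7,26,39); (2713,12,5,15);
  (2729,3,17,24); (2753,8,3,6); (2777,9,13,19); (2801,6,3,9);
  (2833,14,11,25); (2857,23,11,13); (2897,7,17,19); (2953,14,6,7);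
  (2969,14,3,17); (3001,8,13,26); (3041,14,7,8); (3049,34,5,31);
  (3089,14,3,15); (3121,29,6,17); (3137,48,9,27); (3169,20,7,14);
  (3209,8,3,6); (3217,27,10,15); (3257,12,11,17); (3313,11,7,20);
  (3329,7,3,6); (3361,27,11,33); (3433,15,7,12); (3449,18,7,12);
  (3457,15,2,7); (3529,39,10,23); (3593,13,12,14); (3617,7,3,23);
  (3673,38,10,41); (3697,10,15,25); (3761,20,3,30); (3769,7,8,22);
  (3793,3,10,20); (3833,14,6,13); (3881,6,3,9); (3889,39,22,35);
  (3929,14,3,22); (4001,18,34,37); (4049,14,3,9); (4057,29,14,31);
  (4073,12,5,8); (4129,14,7,8); (4153,15,11,28); (4177,22,21,24);
  (4201,24,11,23); (4217,12,5,11); (4241,14,11,17); (4273,15,7,24);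
  (4289,13,3,14); (4297,30,25,47); (4337,14,5,10); (4409,18,7,12);
  (4441,14,7,8); (4457,5,14,19); (4481,9,6,21); (4513,31,5,39);
  (4561,23,2,13); (4649,7,3,6); (4657,20,15,21); (4673,8,3,6);
  (4721,12,10,17); (4729,26,23,34); (4793,8,20,22); (4801,11,28,35);
  (4817,10,6,18); (4889,6,3,9); (4937,18,3,27); (4969,14,8,22);
  (4993,6,17,20); (5009,12,9,15); (5081,12,18,19); (5113,47,21,46);
  (5153,5,7,10); (5209,30,19,34); (5233,26,20,37); (5273,20,8,17);
  (5281,32,7,14); (5297,6,15,19); (5393,14,25,26); (5417,8,3,14);
  (5441,6,3,9); (5449,14,7,8); (5521,18,11,22); (5569,38,15,34);
  (5641,18,7,14); (5657,5,7,10); (5689,14,6,13); (5737,20,15,21);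
  (5801,14,7,8); (5849,22,9,15); (5857,14,3,13); (5881,19,6,39);
  (5897,7,6,8); (5953,8,5,10); (6073,6,19,20); (6089,28,18,27); (6113,8,3,6);
  (6121,14,6,13); (6217,12,10,20); (6257,11,5,7); (6329,6,3,9);
  (6337,20,19,24); (6353,11,5,14); (6361,29,13,34); (6449,18,15,33);
  (6473,7,6,8); (6481,7,12,33); (6521,14,15,21); (6529,23,10,33);
  (6553,23,11,28); (6569,19,15,26); (6577,12,5,10); (6673,11,20,25);
  (6689,24,7,21); (6737,8,3,14); (6761,12,9,27); (6793,26,23,38);
  (6833,10,5,15); (6841,30,22,33); (6857,27,9,26); (6961,14,2,23);
  (6977,7,6,8); (7001,13,3,9); (7057,23,6,20); (7121,15,3,18);
  (7129,14,15,21); (7177,20,2,19); (7193,5,7,10); (7297,8,5,10);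
  (7321,8,7,33); (7369,2,22,33); (7393,21,10,29); (7417,24,10,20);
  (7433,14,7,8); (7457,10,5,15); (7481,13,3,18); (7489,30,23,42);
  (7529,18,6,33); (7537,20,8,10); (7561,39,3,29); (7577,28,9,27);
  (7649,13,3,9); (7673,11,10,15); (7681,18,13,26); (7753,30,3,13);
  (7793,20,18,27); (7817,28,27,30); (7841,24,7,21); (7873,8,5,10);
  (7937,7,6,8); (7993,42,13,41); (8009,20,3,27); (8017,18,10,15);
  (8081,27,34,36); (8089,38,22,41); (8161,24,21,28); (8209,30,14,29);
  (8233,38,30,55); (8273,7,15,24); (8297,20,6,22); (8329,12,7,21);
  (8353,18,13,20); (8369,9,6,21); (8377,8,5,10); (8513,13,12,14);
  (8521,23,18,31); (8537,12,11,17); (8609,22,3,18); (8641,7,8,22);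
  (8681,6,3,9); (8689,30,11,22); (8713,6,7,30); (8737,24,10,20);
  (8753,20,9,10); (8761,38,5,34); (8849,7,3,6); (8929,23,2,13);
  (8969,35,15,21); (9001,30,14,29); (9041,7,3,6); (9049,15,7,14);
  (9137,10,11,14); (9161,13,19,24); (9209,18,3,21); (9241,30,17,47);
  (9257,12,2,11); (9281,12,11,17); (9337,22,20,31); (9377,19,6,9);
  (9433,15,5,25); (9473,12,14,20); (9497,12,5,8); (9521,34,13,22);
  (9601,14,37,47); (9649,28,12,29); (9689,13,6,12); (9697,22,6,23);
  (9721,12,21,28); (9769,38,12,51); (9817,17,15,20); (9833,7,6,8);
  (9857,5,7,10); (9929,8,12,14); (10009,15,7,14); (10169,8,3,6);
  (10177,38,10,35); (10193,14,6,12); (10273,12,5,15); (10289,8,3,6);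
  (10313,5,7,10); (10321,8,14,28); (10337,10,6,17); (10369,23,11,30);
  (10433,18,5,14); (10457,15,5,14); (10513,23,11,42); (10529,6,3,9);
  (10601,6,3,9); (10657,29,10,25); (10729,29,14,28); (10753,11,8,13);
  (10889,14,15,21); (10937,15,5,27); (10993,15,3,13); (11057,18,11,20);
  (11113,46,30,67); (11161,14,15,21); (11177,24,9,23); (11257,31,10,30);
  (11273,7,6,8); (11321,14,3,13); (11329,20,7,29); (11353,8,5,10);
  (11369,6,3,9); (11393,8,3,6); (11489,7,3,6); (11497,14,6,7);
  (11593,11,5,25); (11617,38,23,52); (11633,10,6,18); (11657,11,5,14);
  (11681,6,3,9); (11689,14,7,8); (11777,10,6,17); (11801,18,24,33);
  (11833,21,2,10); (11897,5,7,10); (11953,20,8,19); (11969,15,3,13);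
  (12041,23,3,30); (12049,39,19,42); (12073,37,22,47); (12097,11,14,22);
  (12113,14,6,9); (12161,19,12,27); (12241,29,7,20); (12281,6,3,9);
  (12289,32,11,22); (12329,19,6,27); (12377,20,13,22); (12401,6,3,9);
  (12409,42,11,37); (12433,14,15,20); (12457,25,15,46); (12473,5,14,19);
  (12497,20,9,19); (12553,31,13,24); (12569,12,15,20); (12577,15,3,26);
  (12601,32,11,22); (12641,22,9,12); (12689,6,12,13); (12697,15,23,28);
  (12713,19,12,18); (12721,18,13,26); (12809,6,3,9); (12841,35,14,24);
  (12889,14,22,33); (12953,14,13,15); (13001,7,3,6); (13009,30,14,28);
  (13033,18,13,15); (13049,28,15,21); (13121,15,3,13); (13177,11,8,14);
  (13217,19,11,30); (13241,7,3,6); (13249,14,3,17); (13297,18,10,15);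
  (13313,7,6,8); (13337,13,3,20); (13417,22,21,27); (13441,30,19,34);
  (13457,7,6,8); (13513,25,10,20); (13537,15,2,7); (13553,23,10,20);
  (13577,5,7,10); (13633,24,5,29); (13649,7,14,19); (13681,14,2,13);
  (13697,12,2,11); (13721,6,3,9); (13729,35,17,34); (13841,9,6,21);
  (13873,15,2,10); (13913,6,9,27); (13921,7,12,33); (14009,13,3,9);
  (14033,12,2,11); (14057,8,3,6); (14081,7,3,6); (14153,7,6,8);
  (14177,13,2,12); (14249,9,6,21); (14281,39,8,26); (14321,22,9,12);
  (14369,30,9,39); (14401,38,31,42); (14449,62,29,67); (14489,8,3,6);
  (14537,18,7,11); (14561,6,3,9); (14593,23,10,35); (14633,10,14,17);
  (14657,7,6,8); (14713,3,14,29); (14737,26,37,47); (14753,22,9,24);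
  (14897,7,6,17); (14929,52,22,53); (14969,15,13,18); (15017,20,6,9);
  (15073,31,17,30); (15121,23,20,33); (15137,11,5,7); (15161,12,6,20);
  (15193,5,12,15); (15217,14,31,34); (15233,10,5,15); (15241,23,22,35);
  (15289,23,14,37); (15313,31,14,19); (15329,6,3,9); (15361,58,14,51);
  (15377,20,7,8); (15401,7,3,6); (15473,12,2,11); (15497,12,5,8);
  (15569,24,10,23); (15601,20,7,21); (15641,13,3,9); (15649,20,19,41);
  (15737,5,7,10); (15761,9,12,31); (15809,55,27,36); (15817,12,10,20);
  (15881,14,13,18); (15889,18,14,21); (15913,20,8,19); (15937,2,7,30);
  (16001,12,5,13); (16033,15,2,7); (16057,8,5,10); (16073,10,5,15);
  (16097,8,3,6); (16193,24,14,21); (16217,7,6,8); (16249,47,22,59);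
  (16273,21,10,24); (16361,18,15,24); (16369,8,7,26); (16417,7,17,30);
  (16433,10,6,18); (16481,8,12,24); (16529,6,3,9); (16553,28,27,30);
  (16561,15,7,14); (16633,23,20,35); (16649,10,12,27); (16657,30,7,15);
  (16673,12,21,22); (16729,14,15,21); (16889,6,3,9); (16921,41,18,52);
  (16937,10,5,15); (16993,18,10,20); (17033,6,17,20); (17041,7,15,22);
  (17137,30,7,29); (17209,42,23,49); (17257,24,10,15); (17321,12,9,14);
  (17377,6,17,20); (17393,14,6,9); (17401,12,7,21); (17417,28,3,27);
  (17449,24,14,21); (17489,14,7,8); (17497,45,11,50); (17569,7,15,22);
  (17609,24,10,23); (17657,11,13,14); (17681,14,7,8); (17713,20,8,13);
  (17729,18,7,12); (17737,26,5,22); (17761,32,11,22); (17881,59,21,58);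
  (17921,6,3,9); (17929,56,31,57); (17977,20,3,23); (18041,15,3,18);
  (18049,15,28,34); (18089,6,3,9); (18097,12,5,10); (18121,38,44,63);
  (18169,23,3,29); (18217,15,2,7); (18233,15,5,14); (18257,31,18,45);
  (18289,14,6,17); (18313,20,15,25); (18329,24,19,26); (18353,14,6,9);
  (18401,13,3,9); (18433,20,7,29); (18457,18,5,10); (18481,38,7,26);
  (18521,15,5,11); (18553,15,2,10); (18593,28,3,27); (18617,22,6,21);
  (18713,18,6,13); (18793,14,7,8); (18913,14,7,8); (19001,6,7,20);
  (19009,18,23,46); (19073,10,5,17); (19081,12,7,14); (19121,15,3,18);
  (19249,22,6,17); (19273,30,13,21); (19289,24,9,27); (19417,26,22,35);
  (19433,6,18,19); (19441,35,34,47); (19457,23,6,18); (19489,32,11,22);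
  (19553,8,3,6); (19577,18,20,27); (19609,12,13,26); (19681,18,11,22);
  (19697,12,8,17); (19753,8,5,10); (19777,24,11,23); (19793,13,3,14);
  (19801,8,13,26); (19841,15,5,11); (19889,6,3,9); (19913,14,6,9);
  (19937,8,3,6); (19961,6,3,9); (19993,25,40,71); (20089,24,14,21);
  (20113,31,10,23); (20129,6,3,9); (20161,39,12,38); (20177,20,26,27);
  (20201,8,3,6); (20233,14,7,8); (20249,14,5,19); (20297,25,5,24);
  (20353,27,10,15); (20369,19,6,23); (20393,14,6,12); (20441,6,3,9);
  (20521,23,7,33); (20593,6,7,17); (20641,47,35,61); (20681,19,6,12);
  (20753,8,3,22); (20809,22,7,30); (20849,6,3,9); (20857,21,10,23);
  (20873,5,14,19); (20897,26,12,15); (20921,22,3,18); (20929,12,7,14);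
  (21001,18,11,33); (21017,20,9,27); (21089,15,5,11); (21121,18,23,57);
  (21169,20,13,26); (21193,22,3,33); (21313,26,5,49); (21377,7,2,19);
  (21401,7,3,6); (21433,20,6,15); (21481,24,21,28); (21521,14,3,10);
  (21529,34,6,37); (21569,13,3,18); (21577,23,11,28); (21601,15,14,34);
  (21617,5,7,10); (21649,15,28,35); (21673,23,24,39); (21713,14,6,13);
  (21737,25,3,24); (21817,15,7,12); (21841,39,11,33); (21881,8,3,6);
  (21929,13,3,9); (21937,14,7,18); (21961,46,29,52); (21977,14,19,21);
  (22073,5,7,10); (22129,22,3,34); (22153,8,5,10); (22193,12,2,11);
  (22273,6,7,14); (22369,23,11,22); (22409,6,3,9); (22433,7,6,8);
  (22441,35,14,49); (22481,7,3,6); (22697,30,20,29); (22721,11,7,18);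
  (22769,8,3,6); (22777,50,5,34); (22817,10,5,15); (22921,14,7,8);
  (22937,7,6,8); (22961,7,3,6); (22993,8,5,10); (23017,31,12,39);
  (23041,12,29,39); (23057,12,5,11); (23081,6,3,9); (23201,6,3,9);
  (23209,44,12,33); (23297,10,5,15); (23321,6,3,9); (23369,18,7,12);
  (23417,6,14,20); (23473,20,6,15); (23497,18,13,15); (23537,14,19,23);
  (23561,28,27,36); (23593,12,7,17); (23609,19,12,15); (23633,22,6,17);
  (23689,12,11,33); (23753,5,7,10); (23761,11,28,35); (23801,22,9,23);
  (23833,5,12,15); (23857,38,14,35); (23873,15,5,14); (23929,20,7,21);
  (23977,12,17,20); (23993,26,5,18); (24001,12,7,21); (24049,30,17,34);
  (24097,14,7,8); (24113,12,5,8); (24121,14,6,13); (24137,5,7,10);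
  (24169,14,7,8); (24281,15,3,13); (24329,10,12,27); (24337,6,7,14);
  (24473,14,6,13); (24481,32,11,22); (24593,10,5,15); (24697,11,5,25);
  (24793,11,8,14); (24809,12,9,15); (24841,14,15,35); (24889,32,11,22);
  (24953,12,11,17); (24977,6,9,27); (25033,20,6,15); (25057,20,6,15);
  (25073,12,5,8); (25097,10,5,15); (25121,14,13,18); (25153,12,5,15);
  (25169,28,15,21); (25321,23,18,41); (25409,14,6,9); (25457,12,5,11);
  (25537,23,3,10); (25561,6,17,34); (25577,12,2,11); (25601,28,15,21);
  (25609,24,14,21); (25633,20,13,38); (25657,27,5,15); (25673,22,5,14);
  (25793,11,5,14); (25801,7,8,22); (25841,6,3,9); (25849,39,11,34);
  (25873,20,3,23); (25889,19,15,26); (25913,12,21,22); (25969,29,5,26);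
  (26017,22,5,23); (26041,24,34,51); (26113,8,5,10); (26153,8,3,6);
  (26161,47,12,41); (26177,20,18,27); (26209,38,11,30); (26249,28,18,30);
  (26297,12,21,22); (26321,6,3,9); (26393,7,6,8); (26417,14,3,13);
  (26449,14,7,8); (26489,6,3,9); (26497,60,39,59); (26513,10,6,18);
  (26561,27,3,21); (26633,12,21,22); (26641,7,15,22); (26681,7,3,6);
  (26713,10,18,23); (26729,20,11,22); (26737,11,22,24); (26777,25,5,24);
  (26801,13,3,9); (26833,24,29,30); (26849,22,12,27); (26881,39,11,33);
  (26921,13,3,9); (26953,47,7,41); (26993,14,6,13); (27017,12,6,7);
  (27073,31,10,30); (27241,18,19,38); (27281,14,15,21); (27329,9,6,21);
  (27337,15,5,25); (27361,8,14,28); (27409,38,22,33); (27449,18,3,21);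
  (27457,15,5,11); (27481,22,7,21); (27529,14,2,13); (27617,3,13,14);
  (27673,12,11,17); (27689,6,3,9); (27697,14,2,13); (27737,12,2,11);
  (27793,20,10,23); (27809,12,9,26); (27817,15,10,18); (27953,21,3,14);
  (27961,14,15,35); (28001,27,6,33); (28057,20,2,19); (28081,35,17,34);
  (28097,6,8,12); (28201,7,29,42); (28289,6,3,9); (28297,21,10,25);
  (28393,20,23,38); (28409,12,9,27); (28433,21,3,10); (28513,20,25,38);
  (28537,23,10,33); (28649,5,12,24); (28657,50,14,37); (28697,22,6,21);
  (28729,44,6,37); (28753,51,45,62); (28793,10,5,15); (28817,12,19,21);
  (28921,23,8,19); (28961,6,3,9); (29009,6,3,9); (29017,35,13,23);
  (29033,23,20,25); (29129,7,3,6); (29137,26,19,29); (29153,21,3,10);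
  (29201,18,3,21); (29209,29,21,34); (29297,20,8,17); (29401,19,32,38);
  (29473,8,5,10); (29537,11,10,15); (29569,44,17,43); (29633,8,3,6);
  (29641,15,7,14); (29753,7,6,8); (29761,23,10,33); (29833,21,10,23);
  (29873,10,5,15); (29881,14,3,17); (29921,13,3,9); (30089,29,7,24);
  (30097,20,15,25); (30113,12,2,11); (30137,21,3,14); (30161,14,11,18);
  (30169,11,18,22); (30241,44,10,43); (30313,8,5,10); (30449,8,3,6);
  (30497,14,13,19); (30529,17,39,56); (30553,8,10,20); (30577,22,6,17);
  (30593,7,6,8); (30649,14,7,8); (30689,3,18,30); (30697,20,6,15);
  (30713,13,2,12); (30809,20,21,24); (30817,24,13,21); (30841,14,15,21);
  (30881,3,18,30); (30937,31,29,60); (30977,14,6,13); (31033,60,23,47);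
  (31081,18,13,26); (31121,14,2,17); (31153,21,7,24); (31177,15,7,12);
  (31193,10,5,15); (31249,68,10,67); (31321,22,7,21); (31337,10,6,18);
  (31393,5,12,15); (31481,6,3,9); (31489,7,8,22); (31513,21,10,25);
  (31601,19,12,15); (31649,18,6,13); (31657,7,12,14); (31721,12,5,11);
  (31729,18,7,21); (31769,28,20,27); (31793,7,6,8); (31817,14,6,13);
  (31849,32,14,28); (31873,12,5,15); (32009,15,3,13); (32057,10,5,15);
  (32089,58,23,52); (32233,50,10,41); (32257,20,24,30); (32297,12,11,17);
  (32321,27,3,22); (32353,7,6,20); (32369,6,3,9); (32377,27,5,15);
  (32401,7,8,22); (32441,8,3,6); (32497,23,13,28); (32537,5,7,10);
  (32561,12,9,15); (32569,29,7,24); (32609,19,6,12); (32633,14,6,9);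
  (32713,51,25,35); (32801,8,3,6); (32833,14,2,17); (32969,38,22,37);
  (32993,25,6,20); (33049,38,19,20); (33073,20,13,38); (33113,7,6,8);
  (33161,6,3,9); (33289,32,17,34); (33329,22,6,17); (33353,11,5,7);
  (33377,19,9,21); (33409,15,7,14); (33457,12,5,15); (33521,28,18,27);
  (33529,14,7,8); (33569,20,15,21); (33577,30,14,29); (33601,23,42,44);
  (33617,11,5,14); (33641,15,9,27); (33713,14,21,24); (33721,22,42,59);
  (33769,23,2,13); (33809,6,12,13); (33857,18,19,22); (33889,40,19,38);
  (33937,20,6,15); (33961,38,10,29); (34033,22,2,21); (34057,18,5,10);
  (34129,33,22,45); (34217,20,9,12); (34273,14,15,20); (34297,11,5,27);
  (34313,10,6,18); (34337,10,5,15); (34361,19,24,27); (34369,8,14,28);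
  (34457,15,5,14); (34513,6,14,17); (34537,6,7,14); (34649,6,3,9);
  (34673,12,6,7); (34721,9,12,27); (34729,27,11,22); (34841,15,3,18);
  (34849,38,23,42); (34897,62,38,43); (34913,10,5,15); (34961,15,14,26);
  (35081,30,9,24); (35089,14,15,21); (35129,17,3,20); (35153,19,5,15);
  (35201,15,3,13); (35257,8,5,10); (35281,35,17,46); (35353,8,5,10);
  (35393,8,3,6); (35401,52,12,29); (35449,40,29,39); (35521,22,2,21);
  (35537,18,5,14); (35569,18,11,33); (35593,15,2,7); (35617,23,10,20);
  (35729,6,3,9); (35753,20,10,11); (35801,14,3,17); (35809,53,19,60);
  (35897,11,10,33); (35969,13,3,9); (35977,20,12,15); (35993,28,11,33);
  (36017,10,6,18); (36073,27,10,20); (36097,22,21,24); (36137,19,5,15);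
  (36161,13,3,9); (36209,15,9,27); (36217,6,7,14); (36241,37,15,34);
  (36313,11,5,25); (36353,5,7,10); (36433,18,15,20); (36457,11,5,35);
  (36473,19,6,8); (36497,7,11,19); (36529,43,11,42); (36697,8,5,10);
  (36713,8,12,20); (36721,38,21,40); (36761,6,3,9); (36793,30,14,29);
  (36809,13,3,9); (36833,21,3,20); (36857,22,5,18); (36913,51,25,44);
  (36929,7,3,6); (37049,14,15,18); (37057,26,29,42); (37097,10,5,15);
  (37201,44,14,37); (37217,10,14,21); (37273,15,14,25); (37313,24,7,18);
  (37321,52,24,39); (37337,9,12,19); (37361,18,15,24); (37369,14,2,13);
  (37409,15,3,18); (37441,7,8,22); (37489,38,10,29); (37529,7,3,6);
  (37537,15,3,13); (37561,21,8,22); (37633,51,25,47); (37649,6,3,9);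
  (37657,15,5,25); (37889,6,3,9); (37897,29,7,41); (37993,24,20,23);
  (38113,15,2,7); (38153,7,17,19); (38177,7,6,8); (38201,13,3,18);
  (38273,6,14,17); (38281,22,7,21); (38321,10,12,27); (38329,24,13,26);
  (38377,15,5,11); (38393,7,6,8); (38449,14,7,8); (38561,6,3,9);
  (38569,24,7,26); (38593,20,15,25); (38609,7,3,6); (38713,84,23,83);
  (38729,14,15,20); (38737,8,5,10); (38833,23,13,30); (38873,21,3,14);
  (38921,6,3,9); (38953,15,2,10); (38977,31,5,10); (38993,11,5,7);
  (39041,13,3,9); (39089,13,5,11); (39097,18,10,15); (39113,27,13,44);
  (39161,18,3,34); (39209,6,3,9); (39217,8,5,10); (39233,12,21,22);
  (39241,14,7,18); (39313,20,14,19); (39409,21,10,23); (39521,24,13,15);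
  (39569,14,7,8); (39761,27,18,37); (39769,39,35,38); (39841,23,10,33);
  (39857,28,18,31); (39929,6,3,9); (39937,22,11,12); (39953,10,5,15);
  (40009,7,26,39); (40129,27,7,21); (40153,30,21,35); (40169,14,12,26);
  (40177,23,10,33); (40193,13,5,22); (40241,28,9,27); (40289,14,15,21);
  (40361,31,14,18); (40433,46,9,45); (40529,28,9,27); (40577,21,3,10);
  (40609,32,11,22); (40697,13,3,21); (40801,7,15,22); (40841,13,6,29);
  (40849,23,11,22); (40897,6,7,14); (40961,14,15,21); (40993,47,17,46);
  (41017,15,5,25); (41057,8,3,6); (41081,11,7,18); (41113,14,15,26);
  (41161,38,22,33); (41177,19,6,14); (41201,14,11,18); (41233,20,21,24);
  (41257,50,10,53); (41281,24,13,26); (41513,10,17,20); (41521,44,3,33);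
  (41593,19,2,15); (41609,6,3,9); (41617,25,10,20); (41641,22,2,21);
  (41681,18,19,22); (41729,23,11,18); (41737,15,2,10); (41761,14,15,35);
  (41777,20,11,15); (41801,6,3,9); (41809,32,7,14); (41849,18,7,27);
  (41897,8,3,6); (41953,12,5,15); (41969,9,6,21)]%num.

(* An entry (p, k, r, b, c, d) gives the quadruple (1, b, c, d) in the field of
   order p ^ k, with elements written as polynomials (coefficients in increasing
   degree) in a root of X^k - r. *)
Definition prime_power_witnesses :
    seq (N * nat * seq N * seq N * seq N * seq N) := [::
  (5,2%nat,[::3],[::0;1],[::1;4],[::4;3]);
  (7,2%nat,[::6],[::1;1],[::2;4],[::4;2]);
  (3,4%nat,[::1;2],[::0;0;0;1],[::1;1;0;2],[::2;2;1]);
  (11,2%nat,[::10],[::0;1],[::1;1],[::2;5]);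
  (13,2%nat,[::11],[::5;11],[::6;1],[::9;12]);
  (17,2%nat,[::14],[::14;3],[::10;8],[::4;5]);
  (19,2%nat,[::18],[::16;9],[::0;10],[::12;7]);
  (23,2%nat,[::22],[::7;2],[::4;10],[::16;15]);
  (5,4%nat,[::3],[::0;3;0;2],[::3;4;1;2],[::1;4;3;4]);
  (3,6%nat,[::1;2],[::2;1;2;0;0;2],[::1;2;2;0;2],[::1;2;1;1;1]);
  (29,2%nat,[::27],[::21;17],[::9;4],[::14;26]);
  (31,2%nat,[::30],[::26;19],[::14;4],[::24;2]);
  (37,2%nat,[::35],[::13;28],[::12;33],[::4;5]);
  (41,2%nat,[::38],[::25;7],[::6;20],[::38;39]);
  (43,2%nat,[::42],[::25;29],[::26;13],[::3;18]);
  (47,2%nat,[::46],[::35;32],[::14;26],[::17;42]);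
  (7,4%nat,[::6;6],[::5;2;2;2],[::0;4;2;5],[::1;5;4;3]);
  (53,2%nat,[::51],[::27;46],[::1;33],[::14;48]);
  (59,2%nat,[::58],[::41;32],[::47;11],[::39;56]);
  (61,2%nat,[::59],[::23;21],[::59;9],[::16;16]);
  (67,2%nat,[::66],[::54;38],[::40;19],[::35;8]);
  (17,3%nat,[::14;16],[::15;14;12],[::2;1;11],[::4;10;15]);
  (71,2%nat,[::70],[::25;20],[::52;10],[::45;14]);
  (73,2%nat,[::68],[::46;10],[::35;11],[::57;11]);
  (79,2%nat,[::78],[::3;77],[::31;33],[::26;22]);
  (3,8%nat,[::1;0;2],[::0;1;0;0;0;0;2;1],[::2;1;1;1;2;1;0;1],[::2;0;2;2;1;2;2]);
  (83,2%nat,[::82],[::17;35],[::44;8],[::49;60]);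
  (89,2%nat,[::86],[::37;70],[::32;61],[::40;12]);
  (97,2%nat,[::92],[::61;43],[::49;58],[::14;61]);
  (101,2%nat,[::99],[::91;23],[::84;4],[::10;63]);
  (103,2%nat,[::102],[::2;99],[::5;62],[::94;53]);
  (107,2%nat,[::106],[::68;66],[::27;28],[::85;88]);
  (109,2%nat,[::107],[::84;70],[::64;61],[::76;87]);
  (113,2%nat,[::110],[::38;40],[::45;34],[::41;95]);
  (11,4%nat,[::9;10],[::7;2;1;10],[::9;8;8;3],[::0;9;9;8]);
  (5,6%nat,[::3;4],[::3;2;3;4;0;3],[::3;4;4;2],[::3;1;2;1;0;3]);
  (127,2%nat,[::126],[::11;93],[::39;66],[::47;10]);
  (131,2%nat,[::130],[::32;13],[::62;29],[::115;125]);
  (137,2%nat,[::134],[::126;55],[::79;9],[::76;75]);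
  (139,2%nat,[::138],[::3;83],[::86;79],[::12;53]);
  (149,2%nat,[::147],[::85;90],[::56;2],[::3;125]);
  (151,2%nat,[::150],[::135;25],[::114;73],[::23;104]);
  (157,2%nat,[::155],[::140;55],[::136;108],[::88;12]);
  (163,2%nat,[::162],[::129;48],[::77;72],[::150;127]);
  (167,2%nat,[::166],[::148;77],[::62;85],[::25;139]);
  (13,4%nat,[::11],[::0;8;3;7],[::2;8;0;3],[::2;1;0;2]);
  (173,2%nat,[::171],[::55;109],[::60;10],[::132;48]);
  (179,2%nat,[::178],[::22;178],[::9;32],[::33;98]);
  (181,2%nat,[::179],[::103;74],[::63;76],[::110;89]);
  (191,2%nat,[::190],[::150;129],[::31;184],[::68;117]);
  (193,2%nat,[::188],[::143;184],[::148;179],[::133;137]);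
  (197,2%nat,[::195],[::73;31],[::55;27],[::66;184]);
  (199,2%nat,[::198],[::37;60],[::61;5],[::61;171])]%num.

(** The default 1 is harmless: both checks compare 4 m + 1 with q. *)
Definition quarter (q : N) : positive :=
  match ((q - 1) / 4)%num with N0 => xH | Npos m => m end.

Definition check_prime (q b c d : N) :=
  let m := quarter q in
  N.eqb (4 * Npos m + 1) q &&
  check_good (mulN q) (subN q) N.eqb 1%num m 1%num b c d.

Definition check_prime_power (q p : N) (k : nat) (r b c d : seq N) :=
  let m := quarter q in
  [&& N.eqb (4 * Npos m + 1) q, ~~ N.eqb p 0, (size r <= k)%N, (0 < k)%N,
    eqL p (pow (mulL p k r) [:: 0%num; 1%num] (4 * m + 1)) [:: 0%num; 1%num] &
    check_good (mulL p k r) (subL p) (eqL p) [:: 1%num] m [:: 1%num] b c d].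

Fixpoint least_factor (fuel : nat) (d q : N) : N :=
  if fuel is f.+1 then
    if N.eqb (q mod d)%num 0 then d else least_factor f (d + 2)%num q
  else q.

Fixpoint strip (fuel : nat) (d q : N) : N :=
  if fuel is f.+1 then
    if N.eqb (q mod d)%num 0 then strip f d (q / d)%num else q
  else q.

(** For odd q in the range, the part m prime to the least prime factor exceeds 1 unless q is a prime
    power. The fuel reaches the divisor 221, beyond the square root of 42001, and twelve divisions,
    while 3^10 > 42001. The tests certify coprime factors whatever the search returns. *)
Definition check_composite (q : N) :=
  let m := strip 12 (least_factor 110 3%num q) q in
  let l := (q / m)%num in
  [&& N.eqb (m * l) q, N.eqb (N.gcd m l) 1, N.ltb 1 m & N.ltb 1 l].

Definition powers : seq N :=
  [seq (e.1.1.1.1.1 ^ N.of_nat e.1.1.1.1.2)%num | e <- prime_power_witnesses].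

(** The table of primes is consumed in increasing order as q advances by 8. An order without an
    entry in either table has to pass as composite, so none can be missed. *)
Fixpoint walk (fuel : nat) (q : N) (s : seq (N * N * N * N)) : bool :=
  if fuel is f.+1 then
    if s is (q', b, c, d) :: s' then
      if N.eqb q q' then check_prime q b c d && walk f (q + 8)%num s'
      else (check_composite q || has (N.eqb q) powers) && walk f (q + 8)%num s
    else (check_composite q || has (N.eqb q) powers) && walk f (q + 8)%num s
  else true.

Definition check_powers := all (fun e =>
  let: (p, k, r, b, c, d) := e in
  check_prime_power (p ^ N.of_nat k)%num p k r b c d) prime_power_witnesses.

(** These 5248 steps cover 25, 33, ..., 42001, and 42001 = 4 * 10500 + 1 is where the argument for
    large fields takes over. *)
Lemma walk_ok : walk (82 * 64) 25 prime_witnesses.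
Proof. by vm_compute. Qed.

Lemma check_powers_ok : check_powers.
Proof. by vm_compute. Qed.

(** Vacuous when q is not a prime power, so that [walk] can assert it for every q that it visits. *)
Definition has_good_of_card (q : N) := forall (F : finFieldType) n,
  #|F| = N.to_nat q -> #|F| = (4 * n).+1 -> ~~ odd n ->
  exists a b c d : F, good_quadruple n a b c d.

Lemma to_nat_quadruple m : Pos.to_nat (4 * m + 1) = (4 * Pos.to_nat m).+1.
Proof.
rewrite Pos2Nat.inj_add Pos2Nat.inj_mul.
by move: (Pos.to_nat m) => k; rewrite /Pos.to_nat /=; lia.
Qed.

Lemma quarterP q n : N.eqb (4 * Npos (quarter q) + 1) q ->
  N.to_nat q = (4 * n).+1 -> Pos.to_nat (quarter q) = n.
Proof.
move/N.eqb_eq => {1}<-; rewrite [N.to_nat _](to_nat_quadruple (quarter q)); lia.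
Qed.

Lemma check_primeP q b c d : check_prime q b c d -> has_good_of_card q.
Proof.
case/andP=> qP chk F n cardq cardF n_even.
have <- : Pos.to_nat (quarter q) = n by apply: quarterP; rewrite // -cardq.
have q0 : (N.to_nat q)%:R = 0 :> F by rewrite -cardq natr_card0.
have qn0 : q <> 0%num by move=> e; rewrite e cardF in cardq.
do 4!eexists; apply: (check_goodP (ev := @evN F)) chk.
- exact: evN_mul.
- by move=> x y; apply: evN_sub.
- by [].
- by move=> x y /N.eqb_eq ->.
- exact: two_neq0 cardF.
Qed.

Lemma check_prime_powerP q p k r b c d : q = (p ^ N.of_nat k)%num ->
  check_prime_power q p k r b c d -> has_good_of_card q.
Proof.
move=> q_pk /and5P[qP p_neq0 size_r k0 /andP[chk_r chk]] F n cardq cardF n_even.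
have m_eq : Pos.to_nat (quarter q) = n by apply: quarterP; rewrite // -cardq.
have p0 : (N.to_nat p)%:R = 0 :> F.
  apply/eqP; have := natr_card0 F; rewrite cardq q_pk N2Nat.inj_pow Nat2N.id.
  have -> : forall a e : nat, Nat.pow a e = (a ^ e)%N.
    by move=> a; elim=> //= e ->; rewrite expnS multE.
  by move/eqP; rewrite natrX expf_eq0 => /andP[].
have pn0 : p <> 0%num by move=> e; rewrite e in p_neq0.
have [|w wP] := check_root p0 pn0 size_r k0 _ chk_r.
  by rewrite cardF -m_eq to_nat_quadruple.
rewrite -m_eq; do 4!eexists; apply: (check_goodP (ev := @evL F w)) chk.
- by move=> x y; apply: evL_mul_root.
- by move=> x y; apply: evL_sub.
- by rewrite /= mulr0 addr0.
- by move=> x y; apply: evL_eq.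
- exact: two_neq0 cardF.
Qed.

(** The order of a field is a power of its characteristic, which would divide both coprime
    factors. *)
Lemma check_compositeP q : check_composite q -> has_good_of_card q.
Proof.
rewrite /check_composite; set m := strip _ _ _; set l := (q / m)%num.
case/and4P=> /N.eqb_eq q_ml /N.eqb_eq gcd1 /N.ltb_lt m1 /N.ltb_lt l1 F n cardq.
have [p p_pr pF] := finPcharP F.
have /p_natP[e cardF] : p.-nat #|F|.
  have := abelem_pgroup (fin_ring_pchar_abelem pF); rewrite /pgroup cardsT.
  by [].
have dvd_p j : (1 < N.to_nat j)%N -> (N.to_nat j %| #|F|)%N ->
    N.divide (N.of_nat p) j.
  move=> j1; rewrite cardF => /(dvdn_pfactor _ _ p_pr)[[|i] _ ej].
    by rewrite ej in j1.
  exists (N.of_nat (p ^ i)); apply: N2Nat.inj.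
  by rewrite N2Nat.inj_mul !Nat2N.id multE ej expnSr.
have q_eq : #|F| = (N.to_nat m * N.to_nat l)%N.
  by rewrite cardq -q_ml N2Nat.inj_mul multE.
have pm : N.divide (N.of_nat p) m by apply: dvd_p; [lia | rewrite q_eq dvdn_mulr].
have pl : N.divide (N.of_nat p) l by apply: dvd_p; [lia | rewrite q_eq dvdn_mull].
have := N.gcd_greatest _ _ _ pm pl; rewrite gcd1 => /N.divide_1_r.
by move=> p1; exfalso; have := prime_gt1 p_pr; lia.
Qed.

Lemma powersP q : has (N.eqb q) powers -> has_good_of_card q.
Proof.
have := check_powers_ok; rewrite /check_powers /powers.
elim: prime_power_witnesses => //= -[[[[[p k] r] b] c] d] s IH.
case/andP=> chk /IH {}IH /orP[/N.eqb_eq e|/IH //].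
by rewrite /= in e; apply: (check_prime_powerP e); rewrite e; apply: chk.
Qed.

Lemma walkP f q s i : walk f q s -> (i < f)%N ->
  has_good_of_card (q + 8 * N.of_nat i)%num.
Proof.
elim: f q s i => // f IH q s i /= wk i_lt.
have {wk} [h [s' wk]] : has_good_of_card q /\ exists s', walk f (q + 8)%num s'.
  case: s wk => [|[[[q' b] c] d] s]; [|case: N.eqb_spec => [_|_]].
  - by case/andP=> /orP[/check_compositeP|/powersP] ? ?; split=> //; exists [::].
  - by case/andP=> /check_primeP ? ?; split=> //; exists s.
  - case/andP=> /orP[/check_compositeP|/powersP] ? ?; split=> //;
    by exists ((q', b, c, d) :: s).
case: i i_lt => [_|i i_lt].
  by have -> : (q + 8 * N.of_nat 0 = q)%num by lia.
have -> : (q + 8 * N.of_nat i.+1 = q + 8 + 8 * N.of_nat i)%num by lia.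
exact: IH wk _.
Qed.

Lemma good_of_small (F : finFieldType) n : #|F| = (4 * n).+1 -> ~~ odd n ->
    (n <= 105 * 100)%N -> (17 < #|F|)%N ->
  exists a b c d : F, good_quadruple n a b c d.
Proof.
move=> cardF n_even n_le card_gt.
(* The walk starts at q = 25, where n = 6, and a step of 8 in q adds 2 to n. *)
have n_eq : n = (2 * (n./2 - 3) + 6)%N.
  by have := odd_double_half n; rewrite (negbTE n_even) -muln2; lia.
have := @walkP _ _ _ (n./2 - 3)%N walk_ok.
rewrite /has_good_of_card => /(_ _ F n).
by apply=> //; lia.
Qed.

(** * The field of order 17 *)

Section Order17.

Variable F : finFieldType.
Hypothesis cardF : #|F| = 17%N.

Lemma pchar17 : 17 \in [pchar F].
Proof.
have e17 : 17%:R = 0 :> F by rewrite -[17%N in LHS]cardF natr_card0.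
by rewrite inE e17 eqxx.
Qed.

Lemma natr17_inj i j : (i < 17)%N -> (j < 17)%N -> i%:R = j%:R :> F -> i = j.
Proof.
wlog le_ij : i j / (i <= j)%N => [wl|] i17 j17 e.
  by case/orP: (leq_total i j) => /wl; [apply | move=> h; apply/esym/h].
have : (17 %| j - i)%N by rewrite (dvdn_pcharf pchar17) natrB // e subrr.
by case: (posnP (j - i)) => [|pos /(dvdn_leq pos)]; lia.
Qed.

Lemma natr17_surj (y : F) : exists2 i, (i < 17)%N & y = i%:R.
Proof.
have inj : injective (fun i : 'I_17 => (i : nat)%:R : F).
  by move=> i j /(natr17_inj (ltn_ord i) (ltn_ord j)) /val_inj.
have := inj_card_onto inj; rewrite cardF card_ord => /(_ (leqnn _) y).
by case/codomP=> i ->; exists i.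
Qed.

(** Bijectivity is decided on representatives below 17: [h] inverts [g] by a search through the
    enumeration [ks], and both inverse laws become computations. *)
Lemma exact_on17 (K : Type) (ks : seq K) (k0 : K) (g : K -> nat) (f : K -> F) :
    let h j := nth k0 ks (find (fun k => g k == j) ks) in
    (forall k, f k = (g k)%:R) -> (forall k, h (g k) = k) ->
    (forall k, 0 < g k < 17)%N -> all (fun j => g (h j) == j) (iota 1 16) ->
  exact_on predT f.
Proof.
move=> h fE hK g17 gK; split=> [k k'|y].
  have [/andP[_ k17] /andP[_ k17']] := (g17 k, g17 k').
  by rewrite !fE => /(natr17_inj k17 k17') e; rewrite -(hK k) e hK.
rewrite andbT; split=> [|[k <-]].
  have [i i17 ->] := natr17_surj y.
  case: i i17 => [|i] i17; first by rewrite eqxx.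
  by move=> _; exists (h i.+1); rewrite fE (eqP (allP gK _ _)) // mem_iota.
have /andP[k_gt k17] := g17 k; apply/eqP; rewrite fE.
move/(@natr17_inj _ 0 k17 isT).
by move=> e; rewrite e in k_gt.
Qed.

Definition value17 (i : bool) (p : pos) : nat :=
  if i then match p with
    | pA => 1 | pB => 2 | pC => 4 | pD => 6
    | pE => 15 | pF => 10 | pG => 5 | pH => 11 end
  else match p with
    | pA => 3 | pB => 9 | pC => 13 | pD => 12
    | pE => 16 | pF => 8 | pG => 14 | pH => 7 end.

(** Adding 17 first keeps the subtraction of naturals from truncating. *)
Definition diff17 t (k : bool * edge * bool) : nat :=
  let a := value17 k.1.1 (esrc t k.1.2) in
  let b := value17 k.1.1 (etgt t k.1.2) in
  (if k.2 then (b + 17 - a) %% 17 else (a + 17 - b) %% 17)%N.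

Lemma has_design17 : @has_design F predT.
Proof.
exists bool, (fun i p => (value17 i p)%:R); split=> [|t].
  apply: (@exact_on17 _ [seq (i, p) | i <- [:: true; false],
    p <- [:: pA; pB; pC; pD; pE; pF; pG; pH]] (true, pA)
    (fun k => value17 k.1 k.2)) => //.
  - by case=> [[] []].
  - by case=> [[] []].
apply: (@exact_on17 _ [seq (u, b) | u <- [seq (i, e) | i <- [:: true; false],
  e <- [:: e1; e2; e3; e4]], b <- [:: true; false]] (true, e1, true) (diff17 t)).
- case=> [[i e] b]; rewrite /edge_diff /diff17 /=.
  have mod17 a c : (a <= 17)%N -> (((c + 17 - a) %% 17)%N%:R = c%:R - a%:R :> F).
    move=> a17; rewrite (GRing.natr_mod_pchar pchar17) natrB; last by lia.
    have e17 : 17%:R = 0 :> F by rewrite -cardF natr_card0.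
    by rewrite natrD e17 addr0.
  have le17 i' p : (value17 i' p <= 17)%N by case: i'; case: p.
  by case: b; rewrite /= mod17 // opprB.
- by case: t => -[[[] []] []].
- by case: t => -[[[] []] []].
by case: t.
Qed.

End Order17.

Lemma has_design_field (F : finFieldType) : (9 < #|F|)%N -> #|F| = 1 %[mod 8] ->
  @has_design F predT.
Proof.
move=> F9 F8; have [/eqP F17|F17] := boolP (#|F| == 17%N).
  exact: has_design17.
pose n := (2 * (#|F| %/ 8))%N.
have cardF : #|F| = (4 * n).+1.
  by rewrite /n {1}(divn_eq #|F| 8) F8; lia.
have n_even : ~~ odd n by rewrite /n mul2n odd_double.
have [a [b [c [d good_abcd]]]] : exists a b c d : F, good_quadruple n a b c d.
  have [n_le|n_gt] := leqP n (105 * 100).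
    by apply: good_of_small cardF n_even n_le _; lia.
  exact: good_of_large cardF n_even (ltnW n_gt).
exact: (good_has_design cardF n_even good_abcd).
Qed.

Local Close Scope ring_scope.

Theorem theorem8p1 (v : nat) (v_gt1 : 1 < v)
    (v_comp : forall q : nat, q \in components v -> 9 < q /\ q = 1 %[mod 8]) :
  exists B : {set {set 'Z_2 * Fring v}},
    linear_space [:: 2; 4] (2 * v) B /\ harmonious B.
Proof.
have compP (i : seq_sub (primes v)) :
    (9 < #|comp_field i|)%N /\ #|comp_field i| = 1 %[mod 8].
  by rewrite card_comp_field; apply/v_comp/map_f/ssvalP.
have [I [x xP]] : @has_design (Fring v) predT.
  apply: has_design_prod => i; have [i9 i8] := compP i.
    exact: leq_trans i9.
  exact: has_design_field.
have := design_harmonious xP; rewrite card_Fring ?(ltnW v_gt1) //.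
by apply.
Qed.
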